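(* Let $(\mathcal N,\mathcal O,\mathfrak l)$ be a plabic network with orientation $\mathcal O=\mathcal O(I)$ (i.e. with set of boundary sources indexed by $I$) and gauge ray direction $\mathfrak l$, and let $\bar I=[n]\setminus I$. Let $\{B_j\mid j\in\bar I\}$ be $n-k$ linearly independent vectors assigned to the boundary sinks $b_j$, and let the vectors at the edges $e_j$ ending at the boundary sinks be $E_{e_j}=(-1)^{\mathrm{int}(e_j)}w_{e_j}B_j$, $j\in\bar I$. Consider the linear system, in the unknown vectors $E_e$ at all the edges $e$ not ending at a boundary sink, consisting of the following equations at all the internal vertices: (i) at each bivalent vertex with incoming edge $e$ and outgoing edge $f$: $E_e=(-1)^{\mathrm{int}(e)+\mathrm{wind}(e,f)}w_eE_f$; (ii) at each trivalent black vertex with incoming edges $e_2,e_3$ and outgoing edge $e_1$: $E_{e_2}=(-1)^{\mathrm{int}(e_2)+\mathrm{wind}(e_2,e_1)}w_{e_2}E_{e_1}$ and $E_{e_3}=(-1)^{\mathrm{int}(e_3)+\mathrm{wind}(e_3,e_1)}w_{e_3}E_{e_1}$; (iii) at each trivalent white vertex with incoming edge $e_3$ and outgoing edges $e_1,e_2$: $E_{e_3}=(-1)^{\mathrm{int}(e_3)+\mathrm{wind}(e_3,e_1)}w_{e_3}E_{e_1}+(-1)^{\mathrm{int}(e_3)+\mathrm{wind}(e_3,e_2)}w_{e_3}E_{e_2}$. Then this system has full rank and the number of equations coincides with the number of unknowns; therefore it is consistent and provides a unique system of edge vectors on $(\mathcal N,\mathcal O,\mathfrak l)$. Moreover, if variables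 and equations are properly ordered, the determinant of the matrix $M$ of this linear system is $$\det M=\sum_{C\in\mathcal C(\mathcal G)}w(C),$$ the sum of the weights of all conservative flows in $(\mathcal N,\mathcal O)$.
   Context: Fix positive integers $k<n$; $[n]=\{1,\dots,n\}$. A plabic graph $\mathcal G$ of type $(k,n)$ is a planar directed graph lying inside a disk, with finitely many vertices and edges and with no component isolated from the boundary, such that: it has $n$ boundary vertices $b_1,\dots,b_n$ on the boundary of the disk, labelled clockwise, all lying on a common straight interval of the boundary, each of degree 1 ($b_i$ is a boundary source if its edge is outgoing, a boundary sink if its edge is incoming; exactly $k$ are sources); all other (internal) vertices are strictly inside the disk and are bivalent or trivalent; each internal vertex is incident either to exactly one incoming edge (and is then coloured white) or to exactly one outgoing edge (and is then coloured black), bivalent vertices being assigned either colour. $I=\{i_1<\dots<i_k\}$ is the set of indices of the boundary sources. A plabic network $\mathcal N$ is a plabic graph $\mathcal G$ with a positive weight $w_e$ on each edge $e$. A gauge ray direction $\mathfrak l$ is an oriented direction such that the ray in direction $\mathfrak l$ starting at any boundary vertex points inside the disk, no internal edge is parallel to $\mathfrak l$, and the rays starting at boundary vertices contain no internal vertices of the network. $\mathfrak l_{i}$ is the ray in direction $\mathfrak l$ starting at $b_{i}$. In the definition of winding, oriented edges enter as plane vectors directed by the orientation $\mathcal O$. For an ordered pair $(u,v)$ of vectors that are not antiparallel, $s(u,v)=+1$, $0$, $-1$ if the pair is positively oriented, parallel, negatively oriented, respectively. For consecutive edges $e,f$ (the end vertex $V$ of $e$ is the starting vertex of $f$) that are not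 antiparallel, $\mathrm{wind}(e,f)=+1$ if $s(e,f)=s(e,\mathfrak l)=s(\mathfrak l,f)=1$; $\mathrm{wind}(e,f)=-1$ if $s(e,f)=s(e,\mathfrak l)=s(\mathfrak l,f)=-1$; $\mathrm{wind}(e,f)=0$ otherwise. In the non-generic case in which $(e,f)$ are antiparallel at $V$, the two edge vectors at $V$ are slightly rotated, by an amount controlled by $\epsilon>0$, to a non-antiparallel pair $(e',f')$ respecting the relative position of the two edges near $V$ in the planar drawing, and $\mathrm{wind}(e,f)=\lim_{\epsilon\to0^+}\mathrm{wind}(e',f')$. The number $\mathrm{int}(e)$ is the number of intersections of $e$ with the gauge rays $\mathfrak l_{i_r}$, $r\in[k]$, starting at the boundary sources. A conservative flow is a collection $C$ of distinct edges of $\mathcal G$ such that at each internal vertex the number of edges of $C$ arriving equals the number of edges of $C$ leaving, and $C$ contains no edges incident to the boundary. $\mathcal C(\mathcal G)$ is the set of all conservative flows, including the trivial (empty) one, which has weight 1; $w(C)$ is the product of the weights of all the edges of $C$. The matrix $M$: enumerate the edges $e_r$ not ending at boundary sinks; the $r$-th row corresponds to the equation having $E_{e_r}$ on its left-hand side, with all unknowns moved to the left-hand side, so that $M$ has unit diagonal. *)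

(* Defs.v *)
From HB Require Import structures.
From mathcomp Require Import all_boot all_order all_algebra.
From mathcomp Require Import finmap.
From mathcomp Require Import all_classical all_reals all_analysis.
Import Order.TTheory GRing.Theory Num.Theory.
Import numFieldNormedType.Exports.

Set Implicit Arguments.
Unset Strict Implicit.
Unset Printing Implicit Defensive.

Local Open Scope classical_set_scope.
Local Open Scope ring_scope.

Section PlaneVectors.
Variable R : realType.
Implicit Types u v l p : R * R.

Definition cross u v : R := u.1 * v.2 - u.2 * v.1.

Definition dot u v : R := u.1 * v.1 + u.2 * v.2.

Definition translate p (t : R) v : R * R := (p.1 + t * v.1, p.2 + t * v.2).

Definition rotate (a : R) v : R * R :=
  (cos a * v.1 - sin a * v.2, sin a * v.1 + cos a * v.2).

Definition antiparallel u v : bool := (cross u v == 0) && (dot u v < 0).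

Definition orient u v : int := sgz (cross u v).

Definition wind_generic l u v : int :=
  if [&& orient u v == 1, orient u l == 1 & orient l v == 1] then 1
  else if [&& orient u v == -1, orient u l == -1 & orient l v == -1] then -1
  else 0.

(* Winding of an antiparallel pair; [sigma] is 1 when the second vector departs
   on the left of the first one and -1 when it departs on the right.  The pair
   is rotated so that orient u' v' = sigma; the limit of an integer-valued
   function is its eventual value. *)
Definition wind_antiparallel l (sigma : R) u v : int :=
  xget 0 [set z : int | \forall eps \near 0^'+,
    wind_generic l (rotate (sigma * eps) u) (rotate (- (sigma * eps)) v) = z].

Definition closed_disk : set (R * R) := [set p | p.1 ^+ 2 + p.2 ^+ 2 <= 1].

Definition open_disk : set (R * R) := [set p | p.1 ^+ 2 + p.2 ^+ 2 < 1].

Definition unit_circle : set (R * R) := [set p | p.1 ^+ 2 + p.2 ^+ 2 = 1].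

End PlaneVectors.

(* The vertex [inl i] is the boundary vertex b_(i+1); the vertices [inr v] are
   the internal ones.  The edge [e] is the arc [curve e t], 0 <= t <= 1, and
   the disk is the image of the closed unit disk under [disk_map]. *)
Record drawn_digraph (R : realType) (n : nat) := DrawnDigraph {
  ivertex : finType;
  edge : finType;
  src : edge -> 'I_n + ivertex;
  tgt : edge -> 'I_n + ivertex;
  white : ivertex -> bool;
  pos : 'I_n + ivertex -> R * R;
  curve : edge -> R -> R * R;
  disk_map : R * R -> R * R
}.

Section Graph.
Variables (R : realType) (n : nat) (G : drawn_digraph R n).
Implicit Types (e f : edge G) (v : ivertex G) (i j : 'I_n) (x : 'I_n + ivertex G).

Definition indeg x : nat := #|[set e : edge G | tgt e == x]%SET|.

Definition outdeg x : nat := #|[set e : edge G | src e == x]%SET|.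

Definition degree x : nat := (indeg x + outdeg x)%N.

Definition sources : {set 'I_n} :=
  [set i | [exists e : edge G, src e == inl i]]%SET.

Definition ends_at_sink e : bool := if tgt e is inl _ then true else false.

Definition internal_edge e : bool :=
  match src e, tgt e with inr _, inr _ => true | _, _ => false end.

Definition adjacent : rel ('I_n + ivertex G) :=
  fun x y => [exists e : edge G,
    ((src e == x) && (tgt e == y)) || ((src e == y) && (tgt e == x))].

Definition disk : set (R * R) := disk_map G @` @closed_disk R.

Definition disk_interior : set (R * R) := disk_map G @` @open_disk R.

Definition disk_boundary : set (R * R) := disk_map G @` @unit_circle R.

Definition tangent e (t : R) : R * R :=
  (derive1 (fst \o curve e) t, derive1 (snd \o curve e) t).

Definition is_disk : Prop :=
  {within @closed_disk R, continuous (disk_map G)} /\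
  {in @closed_disk R &, injective (disk_map G)}.

(* The last clause says that the disk lies on the right of the direction
   [d] from b_1 to b_n, i.e. that the labels increase clockwise. *)
Definition boundary_vertices_on_interval : Prop :=
  exists (p d : R * R) (t : 'I_n -> R),
    [/\ forall a, 0 <= a <= 1 -> disk_boundary (translate p a d),
        forall i, 0 < t i < 1 /\ pos (inl i : 'I_n + ivertex G) = translate p (t i) d,
        forall i j, (i < j)%N -> t i < t j
      & forall i, \forall a \near 0^'+,
          disk_interior (translate (pos (inl i : 'I_n + ivertex G)) a (d.2, - d.1))].

(* Edges are regular C^1 arcs, which includes straight segments and allows
   parallel edges.  A C^1 arc over [0, 1] extends to the whole line, and only
   its restriction to [0, 1] is ever used. *)
Definition planar_drawing : Prop :=
  [/\ injective (@pos R n G),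
      forall e, curve e 0 = pos (src e) /\ curve e 1 = pos (tgt e),
      forall e t, [/\ derivable (fst \o curve e) t 1,
        derivable (snd \o curve e) t 1,
        {for t, continuous (derive1 (fst \o curve e))}
        & {for t, continuous (derive1 (snd \o curve e))}],
      forall e t, 0 <= t <= 1 -> tangent e t <> (0, 0) /\ disk (curve e t)
    & forall e f s t, 0 <= s <= 1 -> 0 <= t <= 1 -> curve e s = curve f t ->
        (e = f /\ s = t) \/ ((s = 0 \/ s = 1) /\ (t = 0 \/ t = 1))].

Definition plabic (k : nat) : Prop :=
  [/\ is_disk /\ planar_drawing,
      boundary_vertices_on_interval /\
        (forall v, disk_interior (pos (inr v : 'I_n + ivertex G))),
      (forall i, degree (inl i) = 1%N) /\ #|sources| = k,
      forall v, (degree (inr v) = 2%N \/ degree (inr v) = 3%N) /\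
        (if white v then indeg (inr v) = 1%N else outdeg (inr v) = 1%N)
    & forall v, exists i, connect adjacent (inr v) (inl i)].

(* The starting point of a ray is not counted as a point of the ray, so that
   an edge leaving a boundary source does not meet the ray of that source at
   the source itself. *)
Definition gauge_ray (l : R * R) i : set (R * R) :=
  [set translate (pos (inl i : 'I_n + ivertex G)) t l | t in [set t : R | 0 < t]].

Definition gauge_direction (l : R * R) : Prop :=
  [/\ l <> (0, 0),
      forall i, \forall t \near 0^'+,
        disk_interior (translate (pos (inl i : 'I_n + ivertex G)) t l),
      forall e t, internal_edge e -> 0 <= t <= 1 -> cross l (tangent e t) != 0
    & forall i v, ~ gauge_ray l i (pos (inr v : 'I_n + ivertex G))].

(* For [f] starting at the end vertex of [e] and turning back there: near that
   vertex, [f] lies on the left of [e].  Points of the two edges are compared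
   at equal coordinates along the final direction of [e]. *)
Definition turns_back_left e f : Prop :=
  let u := tangent e 1 in
  exists2 r : R, 0 < r & forall s t : R, 1 - r < s < 1 -> 0 < t < r ->
    dot u (curve e s) = dot u (curve f t) ->
    cross u (curve e s) < cross u (curve f t).

Definition wind (l : R * R) e f : int :=
  let u := tangent e 1 in let v := tangent f 0 in
  if antiparallel u v then
    wind_antiparallel l (if `[< turns_back_left e f >] then 1 else -1) u v
  else wind_generic l u v.

Definition edge_points e : set (R * R) := curve e @` [set t : R | 0 <= t <= 1].

Definition intersections (l : R * R) e : nat :=
  (\sum_(i in sources) #|` fset_set (edge_points e `&` gauge_ray l i)%classic|)%N.

Definition conservative_flow (C : {set edge G}) : bool :=
  [forall v, #|[set e in C | tgt e == inr v]%SET|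
             == #|[set e in C | src e == inr v]%SET|]
  && [forall e in C, internal_edge e].

Section LinearSystem.
Variables (w : edge G -> R) (l : R * R).

Definition coef e f : R := (-1) ^ ((intersections l e)%:Z + wind l e f) * w e.

Section EdgeVectors.
Variable L : vectType R.

Definition bivalent_equations (F : edge G -> L) : Prop :=
  forall v e f, degree (inr v) = 2%N -> tgt e = inr v -> src f = inr v ->
    F e = coef e f *: F f.

Definition black_equations (F : edge G -> L) : Prop :=
  forall v e1 e2 e3, degree (inr v) = 3%N -> ~~ white v ->
    e2 != e3 -> tgt e2 = inr v -> tgt e3 = inr v -> src e1 = inr v ->
    F e2 = coef e2 e1 *: F e1 /\ F e3 = coef e3 e1 *: F e1.

Definition white_equations (F : edge G -> L) : Prop :=
  forall v e1 e2 e3, degree (inr v) = 3%N -> white v ->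
    e1 != e2 -> tgt e3 = inr v -> src e1 = inr v -> src e2 = inr v ->
    F e3 = coef e3 e1 *: F e1 + coef e3 e2 *: F e2.

Definition vertex_equations (F : edge G -> L) : Prop :=
  [/\ bivalent_equations F, black_equations F & white_equations F].

Definition sink_values (B : 'I_n -> L) (F : edge G -> L) : Prop :=
  forall e j, tgt e = inl j -> F e = ((-1) ^+ intersections l e * w e) *: B j.

End EdgeVectors.

Definition equations_at v : nat :=
  if degree (inr v) == 3%N then (if white v then 1 else 2)%N else 1%N.

Definition number_of_equations : nat := (\sum_v equations_at v)%N.

(* [u] lists the unknowns, i.e. the edges not ending at boundary sinks. *)
Definition enumerates_unknowns (m : nat) (u : m.-tuple (edge G)) : Prop :=
  uniq u /\ forall e, (e \in u) = ~~ ends_at_sink e.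

Definition system_matrix (m : nat) (u : m.-tuple (edge G)) : 'M[R]_m :=
  \matrix_(r, s) ((r == s)%:R -
    (if tgt (tnth u r) == src (tnth u s) then coef (tnth u r) (tnth u s) else 0)).

(* The matrix form of the vertex equations, with the known vectors on the
   right-hand side. *)
Lemma vertex_equationsE (k m : nat) (u : m.-tuple (edge G)) (L : vectType R)
    (F : edge G -> L) :
  plabic k -> enumerates_unknowns u ->
  vertex_equations F <->
  forall r, \sum_(s < m) system_matrix u r s *: F (tnth u s) =
    \sum_(f | ends_at_sink f && (src f == tgt (tnth u r))) coef (tnth u r) f *: F f.
Proof.
move=> [_ _ _ Hv _] [Uu Mu].
have rowE r : (\sum_(s < m) system_matrix u r s *: F (tnth u s) =
    \sum_(f | ends_at_sink f && (src f == tgt (tnth u r))) coef (tnth u r) f *: F f)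
  <-> F (tnth u r) =
      \sum_(f | src f == tgt (tnth u r)) coef (tnth u r) f *: F f.
  rewrite [X in _ <-> _ = X](bigID ends_at_sink) /=.
  set S1 := \sum_(f | _ && ends_at_sink f) _.
  set S2 := \sum_(f | _ && ~~ ends_at_sink f) _.
  have -> : \sum_(f | ends_at_sink f && (src f == tgt (tnth u r)))
      coef (tnth u r) f *: F f = S1 by apply: eq_bigl => f; rewrite andbC.
  have -> : \sum_(s < m) system_matrix u r s *: F (tnth u s) = F (tnth u r) - S2.
    have -> : S2 = \sum_(f <- u | src f == tgt (tnth u r)) coef (tnth u r) f *: F f.
      rewrite [RHS]big_mkcond [RHS]big_uniq //= -big_mkcondr /=.
      by apply: eq_bigl => f; rewrite Mu andbC.
    rewrite [X in _ - X]big_tuple [X in _ - X]big_mkcond /=.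
    under eq_bigr do rewrite mxE scalerBl.
    rewrite sumrB; congr (_ - _).
      rewrite (bigD1 r) //= eqxx scale1r big1 ?addr0 // => s /negPf.
      by rewrite eq_sym => ->; rewrite scale0r.
    apply: eq_bigr => s _; rewrite eq_sym; case: ifP => // _.
    by rewrite scale0r.
  by split=> [/eqP|->]; rewrite ?addrK // subr_eq => /eqP.
have card1 (A : {set edge G}) : #|A| = 1%N -> exists e, A = [set e]%SET.
  by move/eqP/cards1P.
split=> [[H2 HB HW] r|H].
  apply/rowE; set e := tnth u r.
  have : ~~ ends_at_sink e by rewrite -Mu mem_tnth.
  rewrite /ends_at_sink; case Et : (tgt e) => [//|v] _.
  have [dv cv] := Hv v.
  have te : e \in [set e | tgt e == inr v]%SET by rewrite inE Et.
  have sumE : \sum_(f | src f == inr v) coef e f *: F f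
      = \sum_(f in [set f | src f == inr v]%SET) coef e f *: F f.
    by apply: eq_bigl => f; rewrite inE.
  rewrite sumE {sumE}.
  have one f : [set f | src f == inr v]%SET = [set f]%SET -> src f = inr v.
    by move=> E; apply/eqP; have := set11 f; rewrite -E inE.
  have in0 : (0 < indeg (inr v))%N by apply/card_gt0P; exists e.
  have [out1|nout1] := eqVneq (outdeg (inr v)) 1%N.
    have [f Ef] := card1 _ out1; rewrite Ef big_set1; have sf := one _ Ef.
    case: dv => dv; first exact: (H2 v e f dv Et sf).
    have i2 : indeg (inr v) = 2%N by apply: (@addIn 1%N); rewrite -[X in (_ + X)%N]out1.
    have bv : ~~ white v by apply/negP => wv; rewrite wv i2 in cv.
    move: i2; rewrite /indeg => /eqP/cards2P [a [b [ab Eab]]].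
    have [ta tb] : tgt a = inr v /\ tgt b = inr v.
      by split; apply/eqP; [have : a \in [set a; b]%SET by rewrite set21
        | have : b \in [set a; b]%SET by rewrite set22]; rewrite -Eab inE.
    have [Fa Fb] := HB v f a b dv bv ab ta tb sf.
    by move: te; rewrite Eab !inE => /orP[]/eqP->.
  have wv : white v.
    by apply: contraT => bv; rewrite (negPf bv) in cv; rewrite cv eqxx in nout1.
  rewrite wv in cv.
  case: dv => dv; move: (dv); rewrite /degree cv add1n => -[dv'].
    by rewrite dv' eqxx in nout1.
  move: dv'; rewrite /outdeg => /eqP/cards2P [a [b [ab Eab]]]; rewrite Eab.
  have [ta tb] : src a = inr v /\ src b = inr v.
    by split; apply/eqP; [have : a \in [set a; b]%SET by rewrite set21
      | have : b \in [set a; b]%SET by rewrite set22]; rewrite -Eab inE.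
  rewrite (HW v a b e) // big_setU1 ?inE //= big_set1 //.
have H' e v : tgt e = inr v ->
    F e = \sum_(f in [set f | src f == inr v]%SET) coef e f *: F f.
  move=> Et; have /tnthP [r er] : e \in u by rewrite Mu /ends_at_sink Et.
  have /rowE := H r; rewrite -er Et => ->.
  by apply: eq_bigl => f; rewrite inE.
have out1 v f : outdeg (inr v) = 1%N -> src f = inr v ->
    [set f | src f == inr v]%SET = [set f]%SET.
  move=> /card1 [g Eg] sf; rewrite Eg; congr [set _]%SET.
  have : f \in [set f | src f == inr v]%SET by rewrite inE sf.
  by rewrite Eg inE => /eqP.
split=> [v e f dv te sf|v e1 e2 e3 dv bv e23 t2 t3 s1|v e1 e2 e3 dv wv e12 t3 s1 s2].
- rewrite (H' _ _ te) (@out1 _ f) ?big_set1 //.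
  have [_] := Hv v; move: dv; rewrite /degree; case: ifP => // _ + i1.
  by rewrite i1 add1n => -[].
- have [_] := Hv v; rewrite (negPf bv) => o1.
  by rewrite (H' _ _ t2) (H' _ _ t3) (@out1 _ e1) // !big_set1.
- have [_] := Hv v; rewrite wv => i1.
  have o2 : outdeg (inr v) = 2%N by move: dv; rewrite /degree i1 add1n => -[].
  have E : [set f | src f == inr v]%SET = [set e1; e2]%SET.
    apply/esym/eqP; rewrite eqEcard cards2 e12 -/(outdeg (inr v)) o2 leqnn andbT.
    by apply/fintype.subsetP => f; rewrite !inE => /orP[]/eqP->; apply/eqP.
  by rewrite (H' _ _ t3) E big_setU1 ?inE //= big_set1.
Qed.

End LinearSystem.
End Graph.

(* Main.v *)
Require Import Defs.
From HB Require Import structures.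
From mathcomp Require Import all_boot all_order all_algebra.
From mathcomp Require Import all_fingroup.
From mathcomp Require Import finmap.
From mathcomp Require Import all_classical all_reals all_analysis.
From mathcomp Require Import ring lra zify.
Import Order.TTheory GRing.Theory Num.Theory.
Import numFieldNormedType.Exports.

Set Implicit Arguments.
Unset Strict Implicit.
Unset Printing Implicit Defensive.

Local Open Scope ring_scope.

(** Expand [\det M], [M = 1 - A], over permutations of the edges.  Since every internal
    vertex has a single incoming or a single outgoing edge, the permutations that
    contribute correspond to the conservative flows, their nontrivial cycles being
    simple closed curves [c] in the drawing.  A cycle of [q] edges contributes
    [(-1)^(q-1)] through the signature, [(-1)^q] through the entries [- A], and
    [(-1)^(int c + wind c)]; so everything comes down to [int c + wind c] being odd.

    With the gauge direction drawn upwards, no internal edge has a vertical tangent, so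
    internal edges are graphs of functions of the abscissa.  At a vertex of [c] the
    winding is odd exactly when the curve folds back and the outgoing edge lies above
    the incoming one.  The number of these folds is odd by Hopf's secant argument
    mod 2: base [c] at its leftmost vertex and, for every pair of edges (the later one
    compared with the earlier one), count the ends of their overlap where the later
    edge is above; the ends contributed by a vertex cancel between its two edges, and
    the pairs of disjoint edges have an even count, so only the folds remain.

    The number [int c] is even: [c] lies in the disk and avoids the boundary vertex [b],
    so it can be contracted in the disk away from [b], towards the point opposite to
    [b].  The parity of the crossings of the ray from [b] with the straight path to that
    opposite point is a potential on the vertices, whose increment along an edge is the
    parity of the crossings of this edge with the ray. *)

(** * Determinants and cycles *)

Lemma prod_porbits (R : comRingType) (m : nat) (s : {perm 'I_m}) (x : 'I_m -> R) :
  \prod_r x r = \prod_(X in porbits s) \prod_(r in X) x r.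
Proof.
rewrite (partition_big (porbit s) (mem (porbits s))) /=; last first.
  by move=> r _; apply: imset_f.
apply: eq_bigr => X /imsetP [r0 _ ->]; apply: eq_bigl => r.
by rewrite eq_porbit_mem.
Qed.

(** The parity of a permutation is that of the number of points plus the number of orbits. One sign
    per point and one per orbit leave [#|X|.-1] signs to the orbit [X]. *)
Lemma sign_perm_porbits (R : comRingType) (m : nat) (s : {perm 'I_m}) :
  (-1) ^+ s = \prod_(X in porbits s) (-1) ^+ #|X|.-1 :> R.
Proof.
have -> : (-1) ^+ s = (-1) ^+ m * (-1) ^+ #|porbits s| :> R.
  by rewrite /odd_perm card_ord signr_addb !signr_odd.
have E : (-1) ^+ m = \prod_(X in porbits s) (-1) ^+ #|X| :> R.
  rewrite -[m in LHS]card_ord -prodr_const (prod_porbits s).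
  by apply: eq_bigr => X _; rewrite prodr_const.
rewrite E -prodr_const -big_split /=; apply: eq_bigr => X /imsetP [r _ ->].
have : (0 < #|porbit s r|)%N by apply/card_gt0P; exists r; apply: porbit_id.
case: #|_| => // k _.
by rewrite /= exprSr -mulrA mulrNN !mulr1.
Qed.

Lemma porbit_fixed (m : nat) (s : {perm 'I_m}) r : s r = r -> porbit s r = [set r].
Proof.
move=> sr; apply/setP => x; rewrite inE; apply/porbitP/eqP => [[i ->]|->].
  by rewrite permX; elim: i => //= i ->.
by exists 0%N; rewrite expg0 perm1.
Qed.

Lemma porbit_moved (m : nat) (s : {perm 'I_m}) r x :
  s r != r -> x \in porbit s r -> s x != x.
Proof.
move=> sr xr; apply: contra sr => /eqP sx.
move: xr; rewrite porbit_sym => /porbitP [i ->].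
have -> : (s ^+ i)%g x = x by rewrite permX; elim: i => //= i ->.
by rewrite sx.
Qed.

(** In the Leibniz formula, a permutation moving some point to a non-adjacent one has a zero factor.
    A fixed point contributes the diagonal entry 1. An orbit of [q > 1] points contributes
    [(-1)^(q-1)] by its signature, [(-1)^q] by the minus signs of the entries and -1 by its odd
    total [bit], so that only the weights remain. *)
Lemma det_signed_adjacency (R : comRingType) (m : nat) (adj : rel 'I_m)
    (bit : 'I_m -> 'I_m -> bool) (w : 'I_m -> R) :
  irreflexive adj ->
  (forall (s : {perm 'I_m}) r, (forall x, s x != x -> adj x (s x)) -> s r != r ->
    \big[addb/false]_(x in porbit s r) bit x (s x)) ->
  \det (\matrix_(r, t) ((r == t)%:R -
      (if adj r t then (-1) ^+ bit r t * w r else 0))) =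
  \sum_(s : {perm 'I_m} | [forall x, (s x != x) ==> adj x (s x)])
    \prod_(r | s r != r) w r.
Proof.
move=> adjF cyc; rewrite /determinant.
rewrite (bigID (fun s : {perm 'I_m} => [forall x, (s x != x) ==> adj x (s x)])) /=.
rewrite [X in _ + X]big1 ?addr0 => [|s]; last first.
  rewrite negb_forall => /existsP [x]; rewrite negb_imply => /andP [sx /negPf nax].
  by rewrite (bigD1 x) //= !mxE nax eq_sym (negPf sx) subr0 mul0r mulr0.
apply: eq_bigr => s /forallP adm.
have {}adm x : s x != x -> adj x (s x) by apply/implyP.
rewrite (sign_perm_porbits R s) (prod_porbits s) -big_split /=.
rewrite [RHS]big_mkcond /= [RHS](prod_porbits s).
apply: eq_bigr => X /imsetP [r _ ->].
have [sr|sr] := eqVneq (s r) r.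
  rewrite (porbit_fixed sr) cards1 expr0 mul1r !big_set1 mxE sr eqxx.
  by rewrite adjF subr0.
have mv x : x \in porbit s r -> s x != x by apply: porbit_moved.
rewrite (eq_bigr (fun x => (-1) * (-1) ^+ bit x (s x) * w x)); last first.
  move=> x /mv sx; rewrite mxE eq_sym (negPf sx) adm // sub0r.
  by rewrite mulN1r mulNr.
rewrite [RHS](eq_bigr w); last by move=> x /mv ->.
rewrite !big_split /= !mulrA prodr_const -[RHS]mul1r; congr (_ * _).
have -> : \prod_(x in porbit s r) (-1) ^+ bit x (s x) = -1 :> R.
  have := congr1 (fun b : bool => (-1) ^+ b : R) (cyc s r adm sr).
  rewrite /= expr1; apply: etrans; apply/esym.
  apply: (big_morph (fun b : bool => (-1) ^+ b : R)) => //.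
  exact: signr_addb.
have : (0 < #|porbit s r|)%N by apply/card_gt0P; exists r; apply: porbit_id.
case: #|_| => // k _; rewrite /= exprSr -!mulrA mulrNN mulr1 mulr1.
by rewrite -expr2 sqrr_sign.
Qed.

(** * Hopf's theorem mod 2 for polygons of graph arcs *)

Section Parity.
Local Open Scope classical_set_scope.

(** The difference of two continuous functions that never agree has no zero, so it keeps its sign by
    the intermediate value theorem. *)
Lemma lt_graph_const (R : realType) (g h : R -> R) (x y : R) :
  {within `[Num.min x y, Num.max x y], continuous g} ->
  {within `[Num.min x y, Num.max x y], continuous h} ->
  (forall z, z \in `[Num.min x y, Num.max x y]%R -> g z != h z) ->
  (g x < h x) = (g y < h y).
Proof.
wlog xy : x y / x <= y => [H|].
  by case/orP: (le_total x y) => [/H//|yx]; rewrite minC maxC => *; apply/esym/H.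
rewrite (min_idPl xy) (max_idPr xy) => cg ch ne.
have cf : {within `[x, y], continuous (h \- g)}.
  by move=> z; apply: continuousB; [exact: ch|exact: cg].
have xin : x \in `[x, y]%R by rewrite in_itv /= lexx.
have yin : y \in `[x, y]%R by rewrite in_itv /= xy lexx.
have := IVT xy cf (v := 0).
case: (ltgtP (g x) (h x)) (ne x xin) => //; case: (ltgtP (g y) (h y)) (ne y yin) => // gy _ gx _ H.
  have [|z zin /eqP] := H; last by rewrite subr_eq0 eq_sym (negPf (ne z zin)).
  by rewrite ge_min le_max /= !subr_le0 !subr_ge0 (ltW gx) (ltW gy) ?orbT.
have [|z zin /eqP] := H; last by rewrite subr_eq0 eq_sym (negPf (ne z zin)).
by rewrite ge_min le_max /= !subr_le0 !subr_ge0 (ltW gx) (ltW gy) ?orbT.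
Qed.

(* [T] is meant to be the plane with its lexicographic order, which breaks the ties
   between vertices of equal abscissa [X]. *)
Variables (d : Order.disp_t) (T : orderType d) (R : realType) (X Y : T -> R).
Hypothesis X_mono : {homo X : a b / (a <= b)%O >-> a <= b}.

Definition strictly_between (u v x : T) : bool := ((u < x < v) || (v < x < u))%O.

Definition xspan (u v : T) : interval R := `[Num.min (X u) (X v), Num.max (X u) (X v)]%R.

Lemma strictly_betweenC u v x : strictly_between u v x = strictly_between v u x.
Proof. by rewrite /strictly_between orbC. Qed.

Lemma xspanC u v : xspan u v = xspan v u.
Proof. by rewrite /xspan minC maxC. Qed.

Lemma xspanl u v : X u \in xspan u v.
Proof. by rewrite in_itv /= ge_min lexx le_max lexx. Qed.

Lemma xspanr u v : X v \in xspan u v.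
Proof. by rewrite xspanC xspanl. Qed.

Lemma strictly_between_xspan u v x : strictly_between u v x -> X x \in xspan u v.
Proof.
rewrite in_itv /= ge_min le_max.
by case/orP => /andP[/ltW/X_mono -> /ltW/X_mono ->]; rewrite ?orbT.
Qed.

Lemma strictly_between_lt u v x : (u < v)%O -> strictly_between u v x = (u < x < v)%O.
Proof.
move=> uv; rewrite /strictly_between; case: (boolP (v < x < u)%O); last by rewrite orbF.
by case/andP => vx xu; have := lt_trans (lt_trans uv vx) xu; rewrite ltxx.
Qed.

(* The lexicographic overlap of two arcs has two ends, each of which is an end
   of exactly one of the arcs, lying strictly over the other one. *)
Lemma disjoint_arcs_parity u u' v v' (A : R -> bool) :
  uniq [:: u; u'; v; v'] ->
  (forall x y, x \in xspan u u' -> x \in xspan v v' ->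
    y \in xspan u u' -> y \in xspan v v' -> A x = A y) ->
  (strictly_between v v' u && A (X u)) (+) (strictly_between v v' u' && A (X u'))
  (+) ((strictly_between u u' v && A (X v)) (+) (strictly_between u u' v' && A (X v')))
  = false.
Proof.
wlog uu' : u u' / (u < u')%O => [H|].
  case: (ltgtP u u') => [/H//|u'u U cA|-> /=]; last by rewrite inE eqxx.
  rewrite -(H u' u u'u) => [||x y]; last by rewrite ![xspan u' u]xspanC; apply: cA.
    by rewrite ![strictly_between u' u _]strictly_betweenC (addbC (_ && A (X u'))).
  by rewrite -(perm_uniq (_ : perm_eq [:: u; u'; v; v'] _)) //;
    apply/seq.permP => f /=; lia.
wlog vv' : v v' / (v < v')%O => [H|].
  case: (ltgtP v v') => [/H//|v'v U cA|-> /=]; last by rewrite !inE ?eqxx !andbF.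
  rewrite -(H v' v v'v) => [||x y]; last by rewrite ![xspan v' v]xspanC; apply: cA.
    by rewrite ![strictly_between v' v _]strictly_betweenC (addbC (_ && A (X v'))).
  by rewrite -(perm_uniq (_ : perm_eq [:: u; u'; v; v'] _)) //;
    apply/seq.permP => f /=; lia.
move=> U cA.
have AA a b : X a \in xspan u u' -> X a \in xspan v v' ->
  X b \in xspan u u' -> X b \in xspan v v' -> A (X a) = A (X b) by move=> *; apply: cA.
have sov := strictly_between_xspan.
move: U; rewrite /= !inE !negb_or => /and4P[/and3P[_ uv uv'] /andP[u'v u'v'] _ _].
rewrite !(strictly_between_lt _ uu') !(strictly_between_lt _ vv').
have in_u x : (u < x < u')%O -> X x \in xspan u u'.
  by rewrite -strictly_between_lt //; apply: sov.
have in_v x : (v < x < v')%O -> X x \in xspan v v'.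
  by rewrite -strictly_between_lt //; apply: sov.
have [in_u0 in_u1] := (xspanl u u', xspanr u u').
have [in_v0 in_v1] := (xspanl v v', xspanr v v').
(* In a consistent order of the four ends, either none of them lies over the other arc, or exactly
   two do (overlapping or nested arcs), and [A] agrees at those two. The other orders contain a
   cycle of three inequalities. *)
case: (ltgtP u v) uv => // uv _; case: (ltgtP u v') uv' => // uv' _;
  case: (ltgtP u' v) u'v => // u'v _; case: (ltgtP u' v') u'v' => // u'v' _ /=.
all: try by match goal with
  H1 : is_true (?a < ?b)%O, H2 : is_true (?b < ?c)%O, H3 : is_true (?c < ?a)%O |- _ =>
    have := lt_trans (lt_trans H1 H2) H3; rewrite ltxx end.
all: rewrite ?addbF; match goal with |- _ (X ?a) (+) _ (X ?b) = false =>
  rewrite (AA a b) ?addbb //; try (by apply: in_u; apply/andP; split);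
  by apply: in_v; apply/andP; split end.
Qed.

(** The lexicographic direction of travel is reversed at [v]: both neighbours lie on the same side
    of it. *)
Definition turned_back (u v v' : T) : bool := ((u < v) && (v' < v) || (v < u) && (v < v'))%O.

(* Of two arcs sharing the end [v], only when they leave it on the same side does
   the nearer of the two other ends lie strictly over the other arc. *)
Lemma adjacent_arcs_parity u v v' (A : R -> bool) (x0 : R) :
  u != v' -> X u != X v -> X v' != X v ->
  (forall x y, x != X v -> y != X v -> x \in xspan u v -> x \in xspan v v' ->
    y \in xspan u v -> y \in xspan v v' -> A x = A y) ->
  (turned_back u v v' -> [/\ x0 != X v, x0 \in xspan u v & x0 \in xspan v v']) ->
  (strictly_between v v' u && A (X u)) (+) (strictly_between u v v' && A (X v'))
  = turned_back u v v' && A x0.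
Proof.
move=> uv' Xuv Xv'v cA.
have uv : u != v by apply: contra_neq Xuv => ->.
have v'v : v' != v by apply: contra_neq Xv'v => ->.
have [in_u0 in_u1] := (xspanl u v, xspanr u v).
have [in_v0 in_v1] := (xspanl v v', xspanr v v').
have su : strictly_between v v' u -> X u \in xspan v v' by apply: strictly_between_xspan.
have sv : strictly_between u v v' -> X v' \in xspan u v by apply: strictly_between_xspan.
move: su sv; rewrite /turned_back /strictly_between.
case: (ltgtP u v) uv => // uv _; case: (ltgtP v' v) v'v => // vv' _;
  case: (ltgtP u v') uv' => // uv' _ /=; rewrite ?orbT ?orbF ?andbT ?andbF //=.
all: try by match goal with
  H1 : is_true (?a < ?b)%O, H2 : is_true (?b < ?c)%O, H3 : is_true (?c < ?a)%O |- _ =>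
    have := lt_trans (lt_trans H1 H2) H3; rewrite ltxx end.
all: rewrite ?addbF; move=> su sv /(_ isT)[x0v x0u x0v'];
  by apply: cA => //; first [exact: su|exact: sv].
Qed.

Lemma addb_sum_shift (f : nat -> bool) p :
  \big[addb/false]_(i < p) (f i (+) f i.+1) = f 0 (+) f p.
Proof.
elim: p => [|p IH]; first by rewrite big_ord0 addbb.
by rewrite big_ord_recr /= IH addbA -(addbA (f 0)) addbb addbF.
Qed.

(** Arc [i] joins [P i] to [P i.+1] along the graph of [g i], and [turn i] belongs to the vertex
    [P i.+1]; indices up to [p.+1] unroll the cycle. A double sum over pairs of arcs is computed
    twice. Summed along the polygon it telescopes to zero, the base vertex being least. Summed pair
    by pair, arcs without a common vertex give zero and consecutive arcs give their [turn], but the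
    pair of the first and the last arc gives the negation of the last [turn]. Hence the turns add up
    to [true]. *)
Lemma turning_parity (p : nat) (P : nat -> T) (g : nat -> R -> R) (turn : nat -> bool) :
  (1 < p)%N -> P p = P 0 -> P p.+1 = P 1 -> g p =1 g 0 ->
  {in gtn p &, injective P} ->
  (forall i, (0 < i < p)%N -> (P 0 < P i)%O) ->
  (forall i, (i < p)%N -> X (P i) != X (P i.+1)) ->
  (forall i, (i < p)%N -> g i (X (P i)) = Y (P i) /\ g i (X (P i.+1)) = Y (P i.+1)) ->
  (forall i, (i < p)%N ->
    {within [set` xspan (P i) (P i.+1)], continuous (g i)}) ->
  (forall i j x, (i < j < p)%N -> x \in xspan (P i) (P i.+1) ->
    x \in xspan (P j) (P j.+1) -> g i x = g j x ->
    exists v, [/\ v \in [:: P i; P i.+1], v \in [:: P j; P j.+1] & x = X v]) ->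
  (forall i, (i < p)%N -> ~~ turned_back (P i) (P i.+1) (P i.+2) -> turn i = false) ->
  (forall i, (i < p)%N -> turned_back (P i) (P i.+1) (P i.+2) ->
    exists x, [/\ g i x != g i.+1 x, x \in xspan (P i) (P i.+1),
      x \in xspan (P i.+1) (P i.+2) & turn i = (g i x < g i.+1 x)]) ->
  \big[addb/false]_(i < p) turn i = true.
Proof.
move=> p1 Pp Pp1 gp Pinj P0 PX gP gC gD turn0 turn1.
pose btw i j := strictly_between (P j) (P j.+1) (P i).
(* The vertex [i] lies strictly (lexicographically) over or under the arc [j], and the
   one of them that comes later along the polygon is above the other. *)
pose c i j := btw i j &&
  (if (i <= j)%N then Y (P i) < g j (X (P i)) else g j (X (P i)) < Y (P i)).
have le0 i : (i <= p)%N -> (P i < P 0)%O = false.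
  case: i => [|i]; rewrite ?ltxx // leq_eqVlt => /orP [/eqP->|ip].
    by rewrite Pp ltxx.
  by apply: lt_gtF; apply: P0.
have b0 j : (j < p)%N -> btw 0 j = false.
  by move=> jp; rewrite /btw /strictly_between !le0 // ltnW.
have c0 j : (j < p)%N -> c 0 j = false by move=> jp; rewrite /c b0.
have cp j : (j < p)%N -> c p j = false.
  by move=> jp; rewrite /c; move: (b0 j jp); rewrite /btw Pp => ->.
pose e i j := c i j (+) c i.+1 j.
have btwl j : btw j j = false by rewrite /btw /strictly_between !ltxx andbF.
have btwr j : btw j.+1 j = false by rewrite /btw /strictly_between !ltxx andbF.
have e0 j : e j j = false by rewrite /e /c btwl btwr.
(* The terms [e b b] vanish, so the two triangles fill the whole square. For fixed [b] the sum over
   [a] telescopes to [c 0 b (+) c p b], which is false because the least vertex lies strictly over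
   no arc. *)
have S0 : \big[addb/false]_(a < p) \big[addb/false]_(b < p | (a < b)%N)
    (e a b (+) e b a) = false.
  under eq_bigr do rewrite big_split /=.
  rewrite big_split /= [X in _ (+) X](exchange_big_dep xpredT) //= -big_split /=.
  under eq_bigr => a _.
    rewrite (_ : _ (+) _ = \big[addb/false]_(b < p) e a b); first over.
    rewrite [RHS](bigID (fun b : 'I_p => (a < b)%N)) /=; congr (_ (+) _).
    rewrite [RHS](bigD1 a) ?ltnn //= e0 addFb; apply: eq_bigl => b.
    by rewrite -leqNgt ltn_neqAle andbC.
  rewrite exchange_big big1 // => b _.
  by rewrite (addb_sum_shift (fun i => c i b)) c0 ?cp.
pose A a b x := g a x < g b x.
(* For [a < b] all four ends ask the same question, whether arc [b] is above arc [a]; the case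
   distinction in [c] is made for this. *)
have eA a b : (a < b < p)%N -> e a b (+) e b a =
    (btw a b && A a b (X (P a))) (+) (btw a.+1 b && A a b (X (P a.+1)))
    (+) ((btw b a && A a b (X (P b))) (+) (btw b.+1 a && A a b (X (P b.+1)))).
  move=> /andP [ab bp]; have ap := ltn_trans ab bp.
  have [ga ga'] := gP a ap; have [gb gb'] := gP b bp.
  rewrite /e /c (ltnW ab) ab leqNgt ab /= [(b < a)%N]ltnNge (ltnW ab) /=.
  by rewrite /A ga ga' gb gb'.
(* The arcs could only meet between [x] and [y] at a common vertex. Its abscissa is extreme for arc
   [a], so it would be [x] or [y], where the arcs are known to differ. *)
have Aconst a b x y : (a < b < p)%N -> g a x != g b x -> g a y != g b y ->
    x \in xspan (P a) (P a.+1) -> x \in xspan (P b) (P b.+1) ->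
    y \in xspan (P a) (P a.+1) -> y \in xspan (P b) (P b.+1) -> A a b x = A a b y.
  move=> abp gx gy xa xb ya yb; have /andP [ab bp] := abp; have ap := ltn_trans ab bp.
  have sub u v : x \in xspan u v -> y \in xspan u v ->
      {subset `[Num.min x y, Num.max x y]%R <= xspan u v}.
    move=> xu yu z; move: xu yu; rewrite !in_itv /=.
    move=> /andP [x1 x2] /andP [y1 y2] /andP [z1 z2].
    apply/andP; split; first by apply: le_trans z1; rewrite le_min x1 y1.
    by apply: le_trans z2 _; rewrite ge_max x2 y2.
  apply: lt_graph_const => [||z zxy].
  - by apply: continuous_subspaceW (gC a ap) => z /= ?; apply: sub.
  - by apply: continuous_subspaceW (gC b bp) => z /= ?; apply: sub.
  apply/negP => /eqP E.
  have [v [va _ zv]] := gD a b z abp (sub _ _ xa ya _ zxy) (sub _ _ xb yb _ zxy) E.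
  suff : (z == x) || (z == y).
    by case/orP => /eqP zE; move: gx gy; rewrite -zE E eqxx.
  have : (z <= x) && (z <= y) || (x <= z) && (y <= z).
    move: xa ya; rewrite !in_itv /= !ge_min !le_max zv.
    by move: va; rewrite !inE => /orP[]/eqP->; lra.
  move: zxy; rewrite in_itv /= ge_min le_max !eq_le.
  by case: (z <= x); case: (x <= z); case: (z <= y); case: (y <= z).
have Pne i j : (i < p)%N -> (j < p)%N -> i != j -> P i != P j.
  by move=> ip jp; apply: contra_neq => /Pinj ->; rewrite ?inE.
have key a b : (a < b < p)%N -> e a b (+) e b a =
    (b == a.+1) && turn a (+) ([&& a == 0%N & b == p.-1] && ~~ turn p.-1).
  move=> abp; have /andP [ab bp] := abp; have ap := ltn_trans ab bp.
  have pm1 : (p.-1 < p)%N by lia.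
  have pS : p.-1.+1 = p by lia.
  have ne x : x \in xspan (P a) (P a.+1) -> x \in xspan (P b) (P b.+1) ->
      (forall v, v \in [:: P a; P a.+1] -> v \in [:: P b; P b.+1] -> x != X v) ->
      g a x != g b x.
    move=> xa xb H; apply/eqP => /(gD a b x abp xa xb) [v [va vb xv]].
    by move: (H v va vb); rewrite xv eqxx.
  have Pab := Pne a b ap bp (negbT (ltn_eqF ab)).
  have [Eb|Nb] := eqVneq b a.+1;
    have [/andP [/eqP Ea /eqP Ep]|Nap] := boolP [&& a == 0%N & b == p.-1].
  (* With only two arcs, each vertex is an end of both, so no end lies strictly over an arc. The two
     turns compare the same arcs in opposite order, hence are opposite. *)
  - rewrite eA // Eb Ea in Ep *; have p2 : p = 2%N by lia.
    rewrite p2 /= in Pp Pp1 gp pm1 turn0 turn1 *.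
    rewrite /btw Pp /strictly_between !ltxx !andbF /=.
    have P01 : (P 0 < P 1)%O by apply: P0; rewrite p2.
    have [||x [gx x0 x1 ->]] := turn1 0%N; [by []| |].
      by rewrite /turned_back Pp P01.
    have [||y [gy y0 y1 ->]] := turn1 1%N; [by []| |].
      by rewrite /turned_back Pp Pp1 P01 orbT.
    move: gy; rewrite !gp -leNgt le_eqVlt eq_sym => gy.
    rewrite (negPf gy) /= -/(A 0 1 x) -/(A 0 1 y).
    rewrite (Aconst 0 1 x y) ?addbb // ?p2 //.
    by move: y1; rewrite Pp Pp1.
  (* Consecutive arcs: the shared vertex counts for nothing, and the two free ends are handled by
     [adjacent_arcs_parity]. *)
  - subst b; rewrite /= addbF eA //.
    rewrite btwl btwr /= addbF /btw.
    have vv : P a.+2 != P a.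
      have [E|N] := eqVneq a.+2 p; last by apply: Pne => //; lia.
      by rewrite E Pp; apply: Pne => //; lia.
    have Xv : X (P a.+2) != X (P a.+1) by rewrite eq_sym PX .
    have gne x : x \in xspan (P a) (P a.+1) -> x \in xspan (P a.+1) (P a.+2) ->
        x != X (P a.+1) -> g a x != g a.+1 x.
      move=> xa xb xv; apply: ne => // v; rewrite !inE.
      case/orP => /eqP -> // /orP[]/eqP E; move: Pab vv; rewrite -?E ?eqxx //.
    have [tb|/negPf tb] := boolP (turned_back (P a) (P a.+1) (P a.+2)).
      have [x [gx xa xb ->]] := turn1 a ap tb.
      rewrite (@adjacent_arcs_parity _ _ _ _ x) ?tb //; first by rewrite eq_sym.
      + by rewrite PX.
      + move=> y z yv zv ya yb za zb; apply: Aconst => //; rewrite //.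
        by apply: gne.
        by apply: gne.
      + move=> _; split=> //; apply: contra_neq gx => ->.
        by rewrite (gP _ bp).1 (gP a ap).2.
    rewrite (turn0 a ap) ?tb // (@adjacent_arcs_parity _ _ _ _ 0) ?tb //.
    + by rewrite eq_sym.
    + by rewrite PX.
    move=> y z yv zv ya yb za zb; apply: Aconst => //; rewrite //.
      by apply: gne.
    by apply: gne.
  (* The first and the last arc share the least vertex, where the polygon necessarily turns back.
     The pair asks whether the last arc is above the first, whereas [turn p.-1] asks whether the
     first is above the last: this is the source of the negation. *)
  - subst a b; rewrite eA // pS.
    rewrite b0 //= /btw pS Pp [strictly_between _ _ (P 0)]/strictly_between.
    rewrite !ltxx andbF /= addbF (strictly_betweenC (P p.-1)) (strictly_betweenC (P 0) (P 1)).
    have P1 : P 1 != P p.-1 by apply: Pne => //; rewrite eq_sym.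
    have P01 : (P 0 < P 1)%O by apply: P0; rewrite p1.
    have P0p : (P 0 < P p.-1)%O by apply: P0; rewrite ab.
    have gne x : x \in xspan (P 0) (P 1) -> x \in xspan (P p.-1) (P 0) ->
        x != X (P 0) -> g 0 x != g p.-1 x.
      move=> xa xb xv; apply: ne; rewrite ?pS ?Pp // => v; rewrite !inE.
      case/orP => /eqP -> // /orP[]/eqP E; move: P1 P01; rewrite E ?eqxx ?ltxx //.
    have tb : turned_back (P p.-1) (P p.-1.+1) (P p.-1.+2).
      by rewrite /turned_back pS Pp Pp1 P0p P01 orbT.
    have [x []] := turn1 _ pm1 tb; rewrite pS gp Pp Pp1 => gx xa xb ->.
    have Xp : X (P p.-1) != X (P 0) by rewrite -Pp -pS PX.
    have X1 : X (P 1) != X (P 0) by rewrite eq_sym PX.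
    rewrite (@adjacent_arcs_parity _ _ _ _ x) //.
    + by rewrite -leNgt [RHS]le_eqVlt eq_sym (negPf gx) /turned_back P0p P01 orbT.
    + move=> y z yv zv ya yb za zb; move: ya za; rewrite !(xspanC (P 1)) => ya za.
      move: yb zb; rewrite !(xspanC (P 0) (P p.-1)) => yb zb.
      by apply: Aconst; rewrite ?pS ?Pp ?ab ?leqnn //; apply: gne.
    + move=> _; split; [|by rewrite xspanC|by rewrite xspanC].
      apply: contra_neq gx => ->.
      by have := (gP _ pm1).2; rewrite (gP 0%N ap).1 pS Pp.
  (* Arcs without a common vertex never meet, so [disjoint_arcs_parity] applies. *)
  - have PXne j : (j < p)%N -> P j != P j.+1.
      by move=> /PX; apply: contra_neq => ->.
    have Pbj j : (0 < j < b.+1)%N -> P j != P b.+1.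
      move=> /andP [j0 jb]; have [E|N] := eqVneq b.+1 p; last by apply: Pne; lia.
      by rewrite E Pp; apply: Pne; lia.
    have n2 : P a != P b.+1.
      have [E|N] := eqVneq b.+1 p; last by apply: Pne; lia.
      by rewrite E Pp; apply: Pne; lia.
    have n3 : P a.+1 != P b by apply: Pne; lia.
    have n4 : P a.+1 != P b.+1 by apply: Pbj; lia.
    rewrite eA // disjoint_arcs_parity //.
      by rewrite /= !inE !negb_or Pab n2 n3 n4 !PXne.
    have gne x : x \in xspan (P a) (P a.+1) -> x \in xspan (P b) (P b.+1) -> g a x != g b x.
      move=> xa xb; apply: ne => // v; rewrite !inE.
      by case/orP => /eqP -> /orP[]/eqP E; move: Pab n2 n3 n4; rewrite E eqxx.
    by move=> y z ya yb za zb; apply: Aconst => //; apply: gne.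
(* Summing [key] over all pairs gives the turns at all indices below [q = p.-1] plus the negation of
   [turn q]; by [S0] this total is false. *)
have [q pq] : exists q, p = q.+1 by exists p.-1; lia.
subst p; rewrite /= in key; have q0 : (0 < q)%N by lia.
move: S0; under eq_bigr => a _ do under eq_bigr => b ab do rewrite key ?ab ?ltn_ord //.
under eq_bigr => a _ do rewrite big_split /=.
rewrite big_split /= big_ord_recr [X in _ (+) X](bigD1 ord0) //=.
rewrite [X in (_ (+) X) (+) _]big1 => [|b]; last by have := ltn_ord b; lia.
rewrite [X in _ (+) (_ (+) X)]big1 ?addbF => [|a]; last first.
  by rewrite -val_eqE /= => /negPf a0; rewrite big1 // => b _; rewrite a0.
rewrite [X in _ (+) X](bigD1 ord_max) //= eqxx /=.
rewrite [X in _ (+) (_ (+) X)]big1 ?addbF => [|b]; last first.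
  by move=> /andP [_]; rewrite -val_eqE /= => /negPf ->.
under eq_bigr => a _.
  rewrite (bigD1 (lift ord0 a)) ?lift0 //= eqxx /= big1 ?addbF => [|b]; first over.
  by move=> /andP [_]; rewrite -val_eqE /= /bump => /negPf ->.
by rewrite big_ord_recr /=; case: (\big[_/_]_(_ | _) _); case: (turn q).
Qed.
End Parity.

(** * Regular arcs *)

Lemma exists_below3 (R : realType) (a b c : R) : 0 < a -> 0 < b -> 0 < c ->
  exists t, [/\ 0 < t, t < a, t < b & t < c].
Proof.
move=> a0 b0 c0; have m0 : 0 < Num.min a (Num.min b c) by rewrite !lt_min a0 b0.
have mh : Num.min a (Num.min b c) / 2 < Num.min a (Num.min b c).
  by rewrite ltr_pdivrMr // ltr_pMr // ltr1n.
exists (Num.min a (Num.min b c) / 2); rewrite divr_gt0 //.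
by split=> //; apply: (lt_le_trans mh); rewrite !ge_min lexx ?orbT.
Qed.

Section Arcs.
Variable R : realType.
Implicit Types (p q u v l : R * R) (e f c : R -> R * R).
Local Open Scope classical_set_scope.

Definition velocity c t : R * R := (derive1 (fst \o c) t, derive1 (snd \o c) t).

Definition C1_arc c : Prop :=
  forall t, [/\ derivable (fst \o c) t 1, derivable (snd \o c) t 1,
    {for t, continuous (derive1 (fst \o c))}
    & {for t, continuous (derive1 (snd \o c))}].

(** Both coordinates relative to the gauge direction, [cross _ l] and [dot _ l], are linear forms,
    as is [dot u]; facts about arcs are proved once for all such forms. *)
Definition functional (a b : R) p : R := a * p.1 + b * p.2.

Lemma functional_is_derive (a b : R) c t : C1_arc c ->
  is_derive t (1 : R) (functional a b \o c) (functional a b (velocity c t)).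
Proof.
move=> /(_ t) [d1 d2 _ _].
have D1 : is_derive t (1 : R) (fst \o c) (derive1 (fst \o c) t).
  by rewrite derive1E; apply/derivableP.
have D2 : is_derive t (1 : R) (snd \o c) (derive1 (snd \o c) t).
  by rewrite derive1E; apply/derivableP.
have := is_deriveD (is_deriveZ a D1) (is_deriveZ b D2).
by [].
Qed.

Lemma functional_derivable (a b : R) c t : C1_arc c ->
  derivable (functional a b \o c) t (1 : R).
Proof. by move=> /functional_is_derive H; have [] := H a b t. Qed.

Lemma functional_derive1 (a b : R) c : C1_arc c ->
  (functional a b \o c)^`() = (fun t => functional a b (velocity c t)).
Proof.
move=> H; apply/funext => t; rewrite derive1E.
by have [_] := functional_is_derive a b t H.
Qed.

Lemma functional_continuous (a b : R) c : C1_arc c -> continuous (functional a b \o c).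
Proof.
move=> H t; apply: differentiable_continuous; apply/derivable1_diffP.
exact: functional_derivable.
Qed.

Lemma functional_velocity_continuous (a b : R) c : C1_arc c ->
  continuous (fun t => functional a b (velocity c t)).
Proof.
move=> H t; have [_ _ c1 c2] := H t.
by rewrite /functional /velocity /=; apply: cvgD; apply: cvgM => //; apply: cvg_cst.
Qed.

Lemma functional_incr (a b x y : R) c : C1_arc c ->
  (forall t, x < t < y -> 0 < functional a b (velocity c t)) ->
  forall s t, x <= s -> s < t -> t <= y -> functional a b (c s) < functional a b (c t).
Proof.
move=> H pos s t; apply: (@gtr0_derive1_incr _ (functional a b \o c)).
- by move=> z _; apply: functional_derivable.
- by move=> z; rewrite in_itv /= functional_derive1 //; apply: pos.
- by apply: continuous_subspaceT; apply: functional_continuous.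
Qed.

Lemma functional_incr_near (a b : R) c t0 : C1_arc c ->
  0 < functional a b (velocity c t0) ->
  exists2 r : R, 0 < r & forall s t, t0 - r <= s -> s < t -> t <= t0 + r ->
    functional a b (c s) < functional a b (c t).
Proof.
move=> H pos.
have nb : nbhs (functional a b (velocity c t0)) [set y | 0 < y].
  by apply: open_nbhs_nbhs; split; [apply: (@open_gt _ 0)|].
have /nbhs_ballP [r /= r0 rP] := functional_velocity_continuous H nb.
exists (r / 2); first by rewrite divr_gt0.
apply: functional_incr => // t /andP [t1 t2]; apply: rP.
by rewrite /ball /= ltr_distlC; lra.
Qed.

Lemma functionalN (a b : R) p : functional (- a) (- b) p = - functional a b p.
Proof. by rewrite /functional; ring. Qed.

(** A continuous derivative without zeros keeps its sign: [lt_graph_const] is applied against the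
    zero function. *)
Lemma functional_sign (a b : R) c : C1_arc c ->
  (forall t, 0 <= t <= 1 -> functional a b (velocity c t) != 0) ->
  (forall t, 0 <= t <= 1 -> 0 < functional a b (velocity c t)) \/
  (forall t, 0 <= t <= 1 -> functional a b (velocity c t) < 0).
Proof.
move=> H ne; pose h t := functional a b (velocity c t).
have same t : 0 <= t <= 1 -> (0 < h 0) = (0 < h t).
  move=> t01; apply: (lt_graph_const (g := fun=> 0)).
  - by apply: continuous_subspaceT => x; apply: cvg_cst.
  - by apply: continuous_subspaceT => x; apply: functional_velocity_continuous.
  - move=> z; rewrite in_itv /= => zt; rewrite eq_sym ne //.
    by move: zt; rewrite min_l ?max_r; lra.
have [p|n] := boolP (0 < h 0); [left|right] => t t01.
  by rewrite -/(h t) -same.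
by rewrite lt_neqAle ne // leNgt -/(h t) -same.
Qed.

Lemma functional_mono (a b : R) c : C1_arc c ->
  (forall t, 0 <= t <= 1 -> functional a b (velocity c t) != 0) ->
  forall s t, 0 <= s -> s < t -> t <= 1 ->
  if 0 < functional a b (velocity c 0) then functional a b (c s) < functional a b (c t)
  else functional a b (c t) < functional a b (c s).
Proof.
move=> H ne s t s0 st t1; have [pos|neg] := functional_sign H ne.
  rewrite pos ?lexx ?ler01 //.
  by apply: (functional_incr H (x := 0) (y := 1)) => // z z01; apply: pos; lra.
rewrite lt_gtF ?neg ?lexx ?ler01 //.
rewrite -ltrN2 -!functionalN.
apply: (functional_incr H (x := 0) (y := 1)) => // z z01.
by rewrite functionalN oppr_gt0; apply: neg; lra.
Qed.

Lemma functional_inj (a b : R) c : C1_arc c ->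
  (forall t, 0 <= t <= 1 -> functional a b (velocity c t) != 0) ->
  forall s t, 0 <= s <= 1 -> 0 <= t <= 1 ->
  functional a b (c s) = functional a b (c t) -> s = t.
Proof.
move=> H ne s t s01 t01 E.
have mono := functional_mono H ne.
case: (ltgtP s t) => // [st|ts].
  by have := mono s t _ st _; rewrite E ltxx if_same; lra.
by have := mono t s _ ts _; rewrite E ltxx if_same; lra.
Qed.

Definition hull (x y : R) : interval R := `[Num.min x y, Num.max x y]%R.

Lemma functional_hull (a b : R) c t : C1_arc c ->
  (forall t, 0 <= t <= 1 -> functional a b (velocity c t) != 0) -> 0 <= t <= 1 ->
  functional a b (c t) \in hull (functional a b (c 0)) (functional a b (c 1)).
Proof.
move=> H ne t01; rewrite in_itv /= ge_min le_max.
have mono := functional_mono H ne.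
have [->|t0] := eqVneq t 0; first by rewrite !lexx.
have [->|t1] := eqVneq t 1; first by rewrite !lexx !orbT.
have := mono 0 t; have := mono t 1.
have [-> ->] : 0 < t /\ t < 1 by rewrite !lt_neqAle eq_sym t0 t1; lra.
by case: ifP; lra.
Qed.

(** The first form is continuous and injective in the parameter, so its inverse is continuous on its
    range. Composing the second form with this inverse presents the arc as the graph of a
    function. *)
Lemma arc_graph (a b a' b' : R) c : C1_arc c ->
  (forall t, 0 <= t <= 1 -> functional a b (velocity c t) != 0) ->
  exists g : R -> R,
  [/\ {within [set` hull (functional a b (c 0)) (functional a b (c 1))], continuous g},
      forall t, 0 <= t <= 1 -> g (functional a b (c t)) = functional a' b' (c t)
    & forall x, x \in hull (functional a b (c 0)) (functional a b (c 1)) ->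
        exists2 t, 0 <= t <= 1 & functional a b (c t) = x].
Proof.
move=> H ne; pose h := functional a b \o c.
have ch : {within `[0, 1], continuous h}.
  by apply: continuous_subspaceT; apply: functional_continuous.
have inj : {in `[0, 1]%R &, injective h}.
  by move=> s t; rewrite !in_itv /=; apply: functional_inj.
have surj x : x \in hull (h 0) (h 1) -> exists2 t, 0 <= t <= 1 & h t = x.
  rewrite in_itv /= => x01; have [t] := IVT (@ler01 R) ch x01.
  by rewrite in_itv; exists t.
(* The default 0 only serves off the range of [h] on the unit interval, where nothing is claimed. *)
pose inv x := xget 0 [set t | 0 <= t <= 1 /\ h t = x].
have hK : {in `[0, 1]%R, cancel h inv}.
  move=> t; rewrite in_itv /= => t01; rewrite /inv; apply: xget_unique => //.
  by move=> s [s01]; apply: functional_inj.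
have cinv : {within [set` hull (h 0) (h 1)], continuous inv}.
  rewrite /hull; have [h01|h10] := leP (h 0) (h 1).
    by apply: segment_can_le_continuous hK => //; apply: ler01.
  by apply: segment_can_ge_continuous hK => //; apply: ler01.
exists (functional a' b' \o c \o inv); split=> //.
  move=> x; apply: (@cvg_comp _ _ _ inv (functional a' b' \o c)).
    exact: cinv.
  by apply: functional_continuous.
by move=> t t01; rewrite /= -[functional a b (c t)]/(h t) hK // in_itv.
Qed.

(** The form approaches the common end along [e] from the same side on which it departs along [f].
    Its values shortly after the start of [f] are therefore taken shortly before the end of [e], by
    the intermediate value theorem. *)
Lemma meet_near (a b : R) e f : C1_arc e -> C1_arc f ->
  functional a b (e 1) = functional a b (f 0) ->
  functional a b (velocity e 1) * functional a b (velocity f 0) < 0 ->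
  forall r, 0 < r -> exists2 r', 0 < r' & forall t, 0 < t < r' ->
    exists2 s, 1 - r < s < 1 & functional a b (e s) = functional a b (f t).
Proof.
move=> He Hf.
wlog pos : a b / 0 < functional a b (velocity e 1) => [W E N r r0|E N r r0].
  have [p|n|z] := ltgtP 0 (functional a b (velocity e 1)); first exact: W.
    have [|||r' r'0 P] := W (- a) (- b) _ _ _ r r0; rewrite ?functionalN ?mulrNN ?E ?oppr_gt0 //.
    exists r' => // t /P [s s1]; rewrite !functionalN => /oppr_inj ?; by exists s.
  by move: N; rewrite -z mul0r ltxx.
have neg : 0 < functional (- a) (- b) (velocity f 0).
  by rewrite functionalN oppr_gt0; move: N; rewrite pmulr_rlt0.
have [r1 r10 e1] := functional_incr_near He pos.
have [r2 r20 f2] := functional_incr_near Hf neg.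
have [r3 [r30 r3r r31 _]] := exists_below3 r0 r10 r10.
have lt3 : functional a b (e (1 - r3)) < functional a b (f 0) by rewrite -E; apply: e1; lra.
have nb : nbhs (functional a b (f 0)) [set y | functional a b (e (1 - r3)) < y].
  by apply: open_nbhs_nbhs; split; [apply: open_gt|].
have /nbhs_ballP [r4 /= r40 r4P] := functional_continuous Hf nb.
have [r' [r'0 r'2 r'4 _]] := exists_below3 r20 r40 r40.
exists r' => // t /andP [t0 tr'].
have [t2 t4] := (lt_trans tr' r'2, lt_trans tr' r'4).
have tlo : functional a b (e (1 - r3)) < functional a b (f t).
  by apply: r4P; rewrite /ball /= sub0r normrN gtr0_norm.
have thi : functional a b (f t) < functional a b (e 1).
  by rewrite E -ltrN2 -!functionalN; apply: f2; lra.
have c1 : {within `[1 - r3, 1], continuous (functional a b \o e)}.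
  by apply: continuous_subspaceT; apply: functional_continuous.
have [||s] := IVT _ c1 (v := functional a b (f t)); first by lra.
  by rewrite ge_min le_max /= (ltW tlo) (ltW thi) orbT.
rewrite in_itv /= => /andP [s1 s2] Es; exists s => //.
apply/andP; split; first by lra.
rewrite lt_neqAle s2 andbT.
by apply: contraTneq thi => <-; rewrite Es ltxx.
Qed.
End Arcs.

(** * Winding at a vertex *)

Section Winding.
Variable R : realType.
Implicit Types (p q u v l : R * R).
Local Open Scope classical_set_scope.

Lemma cross_functionall q l : cross q l = functional l.2 (- l.1) q.
Proof. by rewrite /cross /functional; ring. Qed.

Lemma dot_functionall q l : dot q l = functional l.1 l.2 q.
Proof. by rewrite /dot /functional; ring. Qed.

Lemma dot_functionalr u q : dot u q = functional u.1 u.2 q.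
Proof. by []. Qed.

Lemma crossC u v : cross u v = - cross v u.
Proof. by rewrite /cross; ring. Qed.

(** At a fold [orient u l] and [orient l v] coincide, so the winding is nonzero exactly when
    [orient u v] agrees with them. *)
Lemma odd_wind_generic_fold l u v : cross u l * cross v l < 0 ->
  odd `|wind_generic l u v|%N = (0 < cross u v * cross u l).
Proof.
rewrite /wind_generic /orient (crossC l v) sgzN.
case: (sgzP (cross u l)) => ul; case: (sgzP (cross v l)) => vl; try (by nra);
  case: (sgzP (cross u v)) => uv; move=> _ /=; apply/esym;
  first [by nra | by apply/negbTE; rewrite -leNgt; nra].
Qed.

Lemma wind_generic_straight l u v : 0 < cross u l * cross v l ->
  wind_generic l u v = 0.
Proof.
rewrite /wind_generic /orient (crossC l v) sgzN.
by case: (sgzP (cross u l)) => ul; case: (sgzP (cross v l)) => vl H;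
  try (by exfalso; nra); rewrite /= ?andbF.
Qed.

Lemma sum_sqr_gt0 p : p <> (0, 0) -> 0 < p.1 ^+ 2 + p.2 ^+ 2.
Proof.
move=> p0; rewrite lt_neqAle addr_ge0 ?sqr_ge0 // andbT eq_sym paddr_eq0 ?sqr_ge0 //.
rewrite !sqrf_eq0; apply/negP => /andP [/eqP p1 /eqP p2].
by apply: p0; rewrite [p]surjective_pairing p1 p2.
Qed.

Lemma cross_neq0l u l : cross u l != 0 -> u <> (0, 0).
Proof. by move=> ul E; move: ul; rewrite E /cross !mul0r subrr eqxx. Qed.

(** For parallel vectors [|u|^2 v = (u . v) u]; this is paired with [l] and multiplied by
    [cross u l]. *)
Lemma parallel_cross_mul l u v : cross u v = 0 ->
  (u.1 ^+ 2 + u.2 ^+ 2) * (cross u l * cross v l) = dot u v * cross u l ^+ 2.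
Proof.
move=> uv; have -> : dot u v * cross u l ^+ 2 =
    dot u v * cross u l ^+ 2 - cross u v * cross u l * dot u l by rewrite uv !mul0r subr0.
by rewrite /dot /cross; ring.
Qed.

Lemma antiparallel_fold l u v : antiparallel u v -> cross u l != 0 ->
  cross u l * cross v l < 0.
Proof.
move=> /andP [/eqP uv duv] ul; have u0 := sum_sqr_gt0 (cross_neq0l ul).
by rewrite -(pmulr_rlt0 _ u0) parallel_cross_mul // nmulr_rlt0 // exprn_even_gt0.
Qed.

Lemma fold_antiparallel l u v : cross u v = 0 -> cross u l * cross v l < 0 ->
  antiparallel u v.
Proof.
move=> uv fold; rewrite /antiparallel uv eqxx /= ltNge; apply/negP => d0.
have ul : cross u l != 0 by apply: contraTneq fold => ->; rewrite mul0r ltxx.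
have u0 := sum_sqr_gt0 (cross_neq0l ul).
have : 0 <= (u.1 ^+ 2 + u.2 ^+ 2) * (cross u l * cross v l).
  by rewrite parallel_cross_mul // mulr_ge0 // sqr_ge0.
by rewrite pmulr_rge0 // leNgt fold.
Qed.

Lemma cross_rotate_near l u (b : R) : cross u l != 0 ->
  \forall eps \near (0 : R)^'+, sgz (cross (rotate (b * eps) u) l) = sgz (cross u l).
Proof.
move=> ul; pose h (t : R) := cross (rotate (b * t) u) l.
have ch : {for 0, continuous h}.
  rewrite /h /cross /rotate /=.
  have cb : (b * t)%R @[t --> (0 : R)] --> b * 0 by apply: cvgM; [apply: cvg_cst|].
  have cc : cos (b * t) @[t --> (0 : R)] --> cos (b * 0).
    by apply: (cvg_comp _ _ cb); apply: continuous_cos.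
  have cs : sin (b * t) @[t --> (0 : R)] --> sin (b * 0).
    by apply: (cvg_comp _ _ cb); apply: continuous_sin.
  by apply: cvgB; (apply: cvgM; last exact: cvg_cst);
    [apply: cvgB|apply: cvgD]; (apply: cvgM; last exact: cvg_cst).
have h0 : h 0 = cross u l by rewrite /h /rotate mulr0 cos0 sin0 /cross /=; ring.
have nb : nbhs (h 0) [set y | sgz y = sgz (cross u l)].
  rewrite h0; have [p|n|z] := ltgtP 0 (cross u l); last by rewrite z eqxx in ul.
    apply: filterS (_ : nbhs _ [set y | 0 < y]) => [y /= y0|]; first by rewrite !gtr0_sgz.
    by apply: open_nbhs_nbhs; split; [apply: open_gt|].
  apply: filterS (_ : nbhs _ [set y | y < 0]) => [y /= y0|]; first by rewrite !ltr0_sgz.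
  by apply: open_nbhs_nbhs; split; [apply: open_lt|].
have H : \forall t \near (0 : R), sgz (h t) = sgz (cross u l) := ch _ nb.
by apply: cvg_within; exact: H.
Qed.

(** A small rotation changes neither sign against [l], while the rotated vectors have the
    orientation [sigma]. The eventual winding is thus the sign of [cross u l] if this sign is
    [sigma], and 0 otherwise. *)
Lemma odd_wind_antiparallel l (b : bool) u v : antiparallel u v -> cross u l != 0 ->
  odd `|wind_antiparallel l (if b then 1 else -1)%R u v|%N = (b == (0 < cross u l)).
Proof.
move=> uv ul; set sigma : R := if b then 1 else -1.
have fold := antiparallel_fold uv ul.
have vl : cross v l != 0.
  by apply: contraTneq fold => ->; rewrite mulr0 ltxx.
have [/eqP c0 d0] := andP uv.
pose z : int := if b == (0 < cross u l) then sgz (cross u l) else 0.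
have near_z : \forall eps \near (0 : R)^'+,
    wind_generic l (rotate (sigma * eps) u) (rotate (- (sigma * eps)) v) = z.
  near=> eps.
  have eps0 : 0 < eps by near: eps; exact: nbhs_right_gt.
  have eps1 : eps < 1 by near: eps; exact: nbhs_right_lt.
  have E1 : sgz (cross (rotate (sigma * eps) u) l) = sgz (cross u l).
    by near: eps; apply: cross_rotate_near.
  have E2 : sgz (cross (rotate (- (sigma * eps)) v) l) = sgz (cross v l).
    rewrite -mulNr; near: eps; apply: cross_rotate_near; exact: vl.
  have E3 : sgz (cross (rotate (sigma * eps) u) (rotate (- (sigma * eps)) v)) = sgz sigma.
    have -> : cross (rotate (sigma * eps) u) (rotate (- (sigma * eps)) v) =
        sigma * (2 * sin eps * cos eps * - dot u v).
      have Es : sin (sigma * eps) = sigma * sin eps.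
        by rewrite /sigma; case: (b); rewrite ?mul1r // !mulN1r sinN.
      have Ec : cos (sigma * eps) = cos eps.
        by rewrite /sigma; case: (b); rewrite ?mul1r // !mulN1r cosN.
      rewrite /rotate sinN cosN Es Ec.
      (* The added multiple of [cross u v] is zero; it turns the equality into a polynomial
         identity. *)
      have -> : sigma * (2 * sin eps * cos eps * - dot u v) =
        sigma * (2 * sin eps * cos eps * - dot u v)
        + (cos eps ^+ 2 - sigma ^+ 2 * sin eps ^+ 2) * cross u v by rewrite c0 mulr0 addr0.
      by rewrite /cross /dot /=; ring.
    have s0 : 0 < sin eps by apply: sin_gt0_pi; rewrite eps0 (lt_le_trans eps1) //
      (le_trans _ (pi_ge2 _)) // ler1n.
    have cc0 : 0 < cos eps.
      apply: cos_gt0_pihalf; have := pi_ge2 R; lra.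
    by rewrite sgzM [X in _ * X]gtr0_sgz ?mulr1 // !mulr_gt0 // oppr_gt0.
  rewrite /wind_generic /orient (crossC l) sgzN E1 E2 E3 /z /sigma.
  have [p|n|e0] := ltgtP 0 (cross u l); last by case: (elimN eqP ul).
    have vn : cross v l < 0 by move: fold; rewrite pmulr_rlt0.
    by rewrite (gtr0_sgz p) (ltr0_sgz vn); case: (b); rewrite ?sgzN sgz1.
  have vn : 0 < cross v l by move: fold; rewrite nmulr_rlt0.
  by rewrite (ltr0_sgz n) (gtr0_sgz vn); case: (b); rewrite ?sgzN sgz1.
have -> : wind_antiparallel l sigma u v = z.
  apply: xget_unique => // y near_y.
  suff : \forall eps \near (0 : R)^'+, y = z by case/filter_ex.
  by apply: filterS2 near_y near_z => eps <- <-.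
rewrite /z; case: eqP => // _.
by case: (sgzP (cross u l)) ul => //; rewrite eqxx.
Unshelve. all: by end_near.
Qed.
End Winding.

(** * Comparing two edges near a fold *)

Section Folds.
Variable R : realType.
Implicit Types (p q u v : R * R).
Local Open Scope classical_set_scope.

(** The inequality behind [cusp_left], where [x - c * k] and [- (c * a)] are the components of a
    chord across and along [u]. If [x] did not have the sign of [c * k], then [|x - c * k|] would be
    at least [|c * k|], which is too large because [|a| + 1 > |a|]. *)
Lemma chord_sign (k a c x : R) : k != 0 -> c != 0 ->
  (`|a| + 1) * `|x - c * k| <= `|k| * `|c * a| -> 0 < x * (c * k).
Proof.
move=> k0 c0 H; rewrite ltNge; apply/negP => neg.
have ck0 : 0 < `|c * k| by rewrite normr_gt0 mulf_neq0.
have : `|c * k| <= `|x - c * k|.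
  rewrite -ler_sqr ?nnegrE // -!normrX !ger0_norm ?sqr_ge0 //.
  have := sqr_ge0 x; nra.
move=> H2; have a0 := normr_ge0 a.
have : (`|a| + 1) * `|c * k| <= `|k| * `|c * a|.
  by apply: le_trans H; rewrite ler_wpM2l // addr_ge0.
by rewrite !normrM (mulrA `|k|) (mulrC `|k|) -normrM; nra.
Qed.

(** Up to the scale [|l|], these are the orthogonal coordinates in which [l] points upwards:
    abscissa [cross _ l], height [dot _ l]. *)
Lemma cross_dot_inj l p q : l <> (0, 0) -> cross p l = cross q l -> dot p l = dot q l ->
  p = q.
Proof.
move=> l0 X Y.
have l20 : l.1 ^+ 2 + l.2 ^+ 2 != 0 by rewrite gt_eqF // sum_sqr_gt0.
rewrite [p]surjective_pairing [q]surjective_pairing; congr (_, _);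
  apply: (mulfI l20); move: X Y; rewrite /cross /dot => X Y.
  transitivity (l.2 * (p.1 * l.2 - p.2 * l.1) + l.1 * (p.1 * l.1 + p.2 * l.2)); first by ring.
  by rewrite X Y; ring.
transitivity (l.2 * (p.1 * l.1 + p.2 * l.2) - l.1 * (p.1 * l.2 - p.2 * l.1)); first by ring.
by rewrite X Y; ring.
Qed.

Variables (l : R * R) (e f : R -> R * R).
Hypotheses (l0 : l <> (0, 0)) (He : C1_arc e) (Hf : C1_arc f) (ef : e 1 = f 0).
Hypothesis (e_ne : forall t, 0 <= t <= 1 -> cross (velocity e t) l != 0).
Hypothesis (f_ne : forall t, 0 <= t <= 1 -> cross (velocity f t) l != 0).
Hypothesis disj : forall s t, 0 < s < 1 -> 0 < t < 1 -> e s <> f t.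
Let u := velocity e 1.
Let v := velocity f 0.
Let below s t := dot (e s) l < dot (f t) l.

(** Both edges are graphs over the abscissa. Between the two given abscissas a meeting point would
    be interior to both edges, which [disj] excludes, so [lt_graph_const] applies. *)
Lemma below_const s1 t1 s2 t2 :
  0 < s1 < 1 -> 0 < t1 < 1 -> 0 < s2 < 1 -> 0 < t2 < 1 ->
  cross (e s1) l = cross (f t1) l -> cross (e s2) l = cross (f t2) l ->
  below s1 t1 = below s2 t2.
Proof.
move=> s1P t1P s2P t2P E1 E2.
have ne1 t : 0 <= t <= 1 -> functional l.2 (- l.1) (velocity e t) != 0.
  by rewrite -cross_functionall; apply: e_ne.
have ne2 t : 0 <= t <= 1 -> functional l.2 (- l.1) (velocity f t) != 0.
  by rewrite -cross_functionall; apply: f_ne.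
have [g [cg gE gS]] := arc_graph l.1 l.2 He ne1.
have [h [ch hE hS]] := arc_graph l.1 l.2 Hf ne2.
(* By monotonicity, an abscissa lying between those of two interior points is not that of an end. *)
have inner c : C1_arc c -> (forall t, 0 <= t <= 1 -> functional l.2 (- l.1) (velocity c t) != 0) ->
    forall t t1 t2, 0 < t1 < 1 -> 0 < t2 < 1 -> 0 <= t <= 1 ->
    functional l.2 (- l.1) (c t) \in
      hull (functional l.2 (- l.1) (c t1)) (functional l.2 (- l.1) (c t2)) -> 0 < t < 1.
  move=> Hc ne t a b aP bP tP; rewrite in_itv /= ge_min le_max.
  have mono := functional_mono Hc ne.
  have [E|n0] := eqVneq t 0.
    have := mono 0 a (lexx _); have := mono 0 b (lexx _).
    by rewrite E; case: ifP; lra.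
  have [E|n1] := eqVneq t 1.
    have := mono a 1; have := mono b 1.
    by rewrite E; case: ifP; lra.
  by move=> _; rewrite !lt_neqAle eq_sym n0 n1.
rewrite /below !dot_functionall -!gE -?hE; try lra.
rewrite !cross_functionall in E1 E2; rewrite -E1 -E2.
have in_hull c : C1_arc c ->
    (forall t, 0 <= t <= 1 -> functional l.2 (- l.1) (velocity c t) != 0) ->
    forall t, 0 < t < 1 -> functional l.2 (- l.1) (c t) \in
      hull (functional l.2 (- l.1) (c 0)) (functional l.2 (- l.1) (c 1)).
  by move=> Hc ne t /andP [/ltW ta /ltW tb]; apply: functional_hull; rewrite ?ta.
have sub c : C1_arc c -> (forall t, 0 <= t <= 1 -> functional l.2 (- l.1) (velocity c t) != 0) ->
    forall t1 t2 x, 0 < t1 < 1 -> 0 < t2 < 1 ->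
    x \in hull (functional l.2 (- l.1) (c t1)) (functional l.2 (- l.1) (c t2)) ->
    x \in hull (functional l.2 (- l.1) (c 0)) (functional l.2 (- l.1) (c 1)).
  move=> Hc ne a b x aP bP; have := in_hull c Hc ne a aP; have := in_hull c Hc ne b bP.
  rewrite !in_itv /= !ge_min !le_max; lra.
apply: lt_graph_const.
- by apply: continuous_subspaceW cg => x /= xP; apply: sub xP.
- by apply: continuous_subspaceW ch => x /= xP; apply: (sub f Hf ne2 t1 t2) => //; rewrite -E1 -E2.
move=> z zP; have zP' := zP; rewrite E1 E2 in zP'.
have [s s01 Es] := gS z (sub e He ne1 s1 s2 z s1P s2P zP).
have [t t01 Et] := hS z (sub f Hf ne2 t1 t2 z t1P t2P zP').
have sP : 0 < s < 1 by apply: (inner e He ne1 s s1 s2) => //; rewrite Es.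
have tP : 0 < t < 1 by apply: (inner f Hf ne2 t t1 t2) => //; rewrite Et.
apply/eqP => gh; apply: (disj sP tP); apply: (cross_dot_inj l0).
  by rewrite !cross_functionall Es Et.
by rewrite !dot_functionall -gE // -hE // Es Et.
Qed.

Lemma not_level s t : 0 < s < 1 -> 0 < t < 1 -> cross (e s) l = cross (f t) l ->
  dot (e s) l != dot (f t) l.
Proof. by move=> sP tP X; apply/eqP => Y; apply: (disj sP tP); apply: (cross_dot_inj l0). Qed.

Lemma meet_cross r : 0 < r -> cross u l * cross v l < 0 ->
  exists2 r', 0 < r' & forall t, 0 < t < r' ->
    exists2 s, 1 - r < s < 1 & cross (e s) l = cross (f t) l.
Proof.
move=> r0 fold; have [] := @meet_near R l.2 (- l.1) e f He Hf _ _ r r0.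
- by rewrite ef.
- by rewrite -!cross_functionall.
move=> r' r'0 P; exists r' => // t /P [s sP E]; exists s => //.
by rewrite !cross_functionall.
Qed.

(** The form [phi] has the same sign on [u] and [v], so it is monotone along [e] followed by [f],
    and its value at the vertex separates the two edges. Between points of equal abscissa it differs
    by [c1 < 0] times the difference of heights, so it tells which edge is above. *)
Lemma corner_below : cross u l * cross v l < 0 -> cross u v != 0 ->
  exists s t, [/\ 0 < s < 1, 0 < t < 1, cross (e s) l = cross (f t) l
    & below s t = (0 < cross u v * cross u l)].
Proof.
move=> fold uv.
(* The kernel of the form is the line whose slope is the mean of the slopes of [u] and [v]. *)
pose c1 := cross u l * cross v l * 2; pose c2 := dot u l * cross v l + dot v l * cross u l.
pose a := c1 * l.1 - c2 * l.2; pose b := c1 * l.2 + c2 * l.1.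
have phi p : functional a b p = c1 * dot p l - c2 * cross p l.
  by rewrite /functional /a /b /dot /cross; ring.
have ll := sum_sqr_gt0 l0.
have phiu : functional a b u = - (cross u v * cross u l) * (l.1 ^+ 2 + l.2 ^+ 2).
  by rewrite phi /c1 /c2 /dot /cross; ring.
have phiv : functional a b v * cross u l =
    (cross u v * cross v l) * (l.1 ^+ 2 + l.2 ^+ 2) * cross u l.
  by rewrite phi /c1 /c2 /dot /cross; ring.
have ul : cross u l != 0 by apply: contraTneq fold => ->; rewrite mul0r ltxx.
have vl : cross v l != 0 by apply: contraTneq fold => ->; rewrite mulr0 ltxx.
have {}phiv := mulIf ul phiv.
have find r : 0 < r -> exists s t, [/\ 0 < s < 1, 1 - r < s, 0 < t < 1, t < r
    & cross (e s) l = cross (f t) l].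
  move=> r0; have [q [q0 qr q1 _]] := exists_below3 r0 ltr01 ltr01.
  have [r' r'0 P] := meet_cross q0 fold.
  have [t [t0 tr' tr t1]] := exists_below3 r'0 r0 ltr01.
  have [|s /andP [s0 s1] E] := P t; first by rewrite t0.
  by exists s, t; split=> //; lra.
have step (a' b' : R) : 0 < functional a' b' u -> 0 < functional a' b' v ->
  exists s t, [/\ 0 < s < 1, 0 < t < 1, cross (e s) l = cross (f t) l
    & functional a' b' (e s) < functional a' b' (f t)].
  move=> pu pv; have [r1 r10 P1] := functional_incr_near He pu.
  have [r2 r20 P2] := functional_incr_near Hf pv.
  have [q [q0 q1 q2 _]] := exists_below3 r10 r20 r20.
  have [s [t [sP s1 tP t1 E]]] := find q q0.
  exists s, t; split=> //; apply: (@lt_trans _ _ (functional a' b' (e 1))).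
    by apply: P1; [lra|by case/andP: sP|rewrite lerDl ltW].
  by rewrite ef; apply: P2; [rewrite gerBl ltW|by case/andP: tP|lra].
have key : cross u v * cross u l * (cross u v * cross v l) < 0.
  have -> : cross u v * cross u l * (cross u v * cross v l) =
    cross u v ^+ 2 * (cross u l * cross v l) by ring.
  by rewrite pmulr_rlt0 // exprn_even_gt0.
have [pos|npos] := boolP (0 < cross u v * cross u l).
  have neg : cross u v * cross v l < 0 by move: key; rewrite pmulr_rlt0.
  have [||s [t [sP tP E lt]]] := step (- a) (- b).
  - by rewrite functionalN phiu mulNr opprK mulr_gt0.
  - by rewrite functionalN phiv oppr_gt0 pmulr_llt0.
  exists s, t; split=> //; rewrite /below; move: lt.
  by rewrite !functionalN !phi E ltrN2 ltrD2r /c1 ltr_nM2l // pmulr_llt0.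
have neg : cross u v * cross u l < 0.
  by rewrite lt_neqAle leNgt npos andbT mulf_neq0.
have pos : 0 < cross u v * cross v l by move: key; rewrite nmulr_rlt0.
have [||s [t [sP tP E lt]]] := step a b.
- by rewrite phiu mulr_gt0 // oppr_gt0.
- by rewrite phiv mulr_gt0.
exists s, t; split=> //; rewrite /below lt_gtF //; move: lt.
by rewrite !phi E ltrD2r /c1 ltr_nM2l // pmulr_llt0.
Qed.

(* Near the cusp the chords of [e] are almost parallel to [u], so comparing the two
   edges along [l] amounts to comparing them along the normal of [u]. *)
Lemma cusp_left (b : bool) : antiparallel u v ->
  (forall s t, 0 < s < 1 -> 0 < t < 1 -> cross (e s) l = cross (f t) l -> below s t = b) ->
  exists2 r : R, 0 < r & forall s t, 1 - r < s < 1 -> 0 < t < r ->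
    dot u (e s) = dot u (f t) ->
    if b == (0 < cross u l) then cross u (e s) < cross u (f t)
    else cross u (f t) < cross u (e s).
Proof.
move=> uv below_b.
have ul : cross u l != 0 by apply: e_ne; lra.
have fold := antiparallel_fold uv ul.
set k := cross u l in ul *; set a := dot u l.
(* For [z] equal to 1 and to -1 the form is positive on [u], hence increases along [e] near its end.
   The two resulting inequalities give [chord], which bounds chords of [e] across [u] by their
   extent along [u]. *)
pose A (z : R) := `|k| * u.1 + z * (`|a| + 1) * - u.2.
pose B (z : R) := `|k| * u.2 + z * (`|a| + 1) * u.1.
have AB z p : functional (A z) (B z) p = `|k| * dot u p + z * (`|a| + 1) * cross u p.
  by rewrite /functional /A /B /dot /cross; ring.
have ABu z : 0 < functional (A z) (B z) u.
  rewrite AB /cross (mulrC u.1) subrr mulr0 addr0 mulr_gt0 ?normr_gt0 // /dot -!expr2.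
  exact: sum_sqr_gt0 (cross_neq0l ul).
have [r1 r10 P1] := functional_incr_near He (ABu 1).
have [r2 r20 P2] := functional_incr_near He (ABu (-1)).
have [r3 [r30 r31 r32 r312]] := exists_below3 r10 r20 ltr01.
have chord s s' : 1 - r3 < s < 1 -> 1 - r3 < s' < 1 ->
  (`|a| + 1) * `|cross u (e s') - cross u (e s)| <= `|k| * `|dot u (e s') - dot u (e s)|.
  wlog ss' : s s' / s <= s' => [W sP s'P|sP s'P].
    have [/W|/ltW /W] := leP s s'; first exact.
    by move=> /(_ s'P sP); rewrite distrC (distrC (dot u (e s))).
  move: ss'; rewrite le_eqVlt => /orP [/eqP ->|ss'].
    by rewrite !subrr !normr0 !mulr0.
  have lo1 : 1 - r1 <= s by lra.
  have lo2 : 1 - r2 <= s by lra.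
  have hi1 : s' <= 1 + r1 by lra.
  have hi2 : s' <= 1 + r2 by lra.
  have := P1 s s' lo1 ss' hi1; have := P2 s s' lo2 ss' hi2; rewrite !AB mul1r => H2 H1.
  have D0 : `|k| * (dot u (e s') - dot u (e s)) <= `|k| * `|dot u (e s') - dot u (e s)|.
    by rewrite ler_wpM2l // ler_norm.
  apply: le_trans D0.
  have a1 : 0 <= `|a| + 1 by rewrite addr_ge0.
  rewrite -[X in X * _ <= _](ger0_norm a1) -normrM ler_norml.
  move: H1 H2; set ka := `|k|; set aa := `|a|.
  by move=> H1 H2; apply/andP; split; nra.
have [r' r'0 meet] := meet_cross r30 fold.
have [r [r_0 rr3 rr' r1']] := exists_below3 r30 r'0 ltr01.
exists r => // s t /andP [sr s1] /andP [t0 tr] E.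
have sP : 1 - r3 < s < 1 by rewrite s1 andbT (lt_trans _ sr) // ltrD2l ltrN2.
have [tr' t1] := (lt_trans tr rr', lt_trans tr r1').
have [|s' s'P E'] := meet t; first by rewrite t0.
have s'1 : 0 < s' < 1 by case/andP: s'P => s'0 ->; rewrite andbT (lt_trans _ s'0) // subr_gt0.
have t1' : 0 < t < 1 by rewrite t0.
have bst := below_b s' t s'1 t1' E'.
have nl := not_level s'1 t1' E'.
have {}chord := chord s s' sP s'P.
have ll := sum_sqr_gt0 l0.
(* Having the same abscissa, [e s'] and [f t] differ by [c * l], and [b] is the sign of [c]. Then
   [chord_sign] transfers this sign to the comparison across [u]. *)
pose c := (dot (f t) l - dot (e s') l) / (l.1 ^+ 2 + l.2 ^+ 2).
have c0 : c != 0 by rewrite /c mulf_eq0 invr_eq0 (gt_eqF ll) orbF subr_eq0 eq_sym.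
have bc : b = (0 < c) by rewrite -bst /below /c pmulr_lgt0 ?invr_gt0 // subr_gt0.
have ftE : f t = ((e s').1 + c * l.1, (e s').2 + c * l.2).
  apply: (cross_dot_inj l0); first by rewrite -E' /cross /=; ring.
  have -> : dot (f t) l = dot (e s') l + c * (l.1 ^+ 2 + l.2 ^+ 2).
    by rewrite /c divfK ?gt_eqF // addrC subrK.
  by rewrite /dot /=; ring.
have D : dot u (e s') - dot u (e s) = - (c * a).
  by rewrite E ftE /a /dot /=; ring.
have K : cross u (e s') - cross u (e s) = (cross u (f t) - cross u (e s)) - c * k.
  by rewrite ftE /k /cross /=; ring.
rewrite D K normrN in chord.
have := chord_sign ul c0 chord.
rewrite bc; have [cp|cn|/esym/eqP] := ltgtP 0 c; last by rewrite (negPf c0).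
  have [kp|kn|/esym/eqP] := ltgtP 0 k; last by rewrite (negPf ul).
    by rewrite eqxx pmulr_lgt0 ?subr_gt0 // mulr_gt0.
  by rewrite nmulr_lgt0 ?subr_lt0 // pmulr_rlt0.
have [kp|kn|/esym/eqP] := ltgtP 0 k; last by rewrite (negPf ul).
  by rewrite nmulr_lgt0 ?subr_lt0 // nmulr_rlt0.
by rewrite eqxx pmulr_lgt0 ?subr_gt0 // nmulr_rgt0.
Qed.
End Folds.

(** * Parity of the winding at a fold *)

Section GraphWinding.
Variables (R : realType) (n : nat) (G : drawn_digraph R n) (l : R * R).
Local Open Scope classical_set_scope.

(** At a true corner the tangents decide which edge is above. At a cusp the winding depends on the
    side on which [f] turns back, which [cusp_left] expresses by the order of heights. *)
Lemma odd_wind_fold (e f : edge G) : l <> (0, 0) ->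
  C1_arc (curve e) -> C1_arc (curve f) -> curve e 1 = curve f 0 ->
  (forall t, 0 <= t <= 1 -> cross (tangent e t) l != 0) ->
  (forall t, 0 <= t <= 1 -> cross (tangent f t) l != 0) ->
  (forall s t, 0 < s < 1 -> 0 < t < 1 -> curve e s <> curve f t) ->
  cross (tangent e 1) l * cross (tangent f 0) l < 0 ->
  exists s t, [/\ 0 < s < 1, 0 < t < 1, cross (curve e s) l = cross (curve f t) l
    & odd `|wind l e f|%N = (dot (curve e s) l < dot (curve f t) l)].
Proof.
move=> l0 He Hf ef e_ne f_ne disj fold.
rewrite /wind; case: ifPn => [uv|nuv]; last first.
  have uv : cross (tangent e 1) (tangent f 0) != 0.
    by apply: contra nuv => /eqP uv; apply: fold_antiparallel fold.
  have [s [t [sP tP E lt]]] := corner_below l0 He Hf ef fold uv.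
  by exists s, t; split=> //; rewrite odd_wind_generic_fold.
have [r' r'0 meet] := meet_cross He Hf ef (ltr01 : 0 < (1 : R)) fold.
have [t [t0 tr' t1 _]] := exists_below3 r'0 ltr01 ltr01.
have [|s sP E] := meet t; first by rewrite t0.
have sP' : 0 < s < 1 by move: sP; rewrite subrr.
have tP : 0 < t < 1 by rewrite t0.
exists s, t; split=> //.
set b := _ < _.
have ul : cross (tangent e 1) l != 0 by apply: e_ne; lra.
rewrite odd_wind_antiparallel //.
have [r r0 left_r] : exists2 r : R, 0 < r & forall s t, 1 - r < s < 1 -> 0 < t < r ->
    dot (tangent e 1) (curve e s) = dot (tangent e 1) (curve f t) ->
    if b == (0 < cross (tangent e 1) l)
    then cross (tangent e 1) (curve e s) < cross (tangent e 1) (curve f t)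
    else cross (tangent e 1) (curve f t) < cross (tangent e 1) (curve e s).
  apply: (cusp_left l0 He Hf ef e_ne disj uv) => s1 t2 s1P t2P E1.
  exact: (below_const l0 He Hf e_ne f_ne disj).
(* If [f] turned back on the left against [left_r], two opposite strict inequalities would hold at
   any pair of points near the vertex with equal [dot]; [meet_near] supplies such a pair. *)
have -> : `[< turns_back_left e f >] = (b == (0 < cross (tangent e 1) l)).
  apply/asboolP/idP => [|bP]; last first.
    by exists r => // s1 t2 s1P t2P E1; have := left_r s1 t2 s1P t2P E1; rewrite bP.
  move=> [r2 r20 left_r2]; apply: contraT => /negPf nb.
  have [_ d0] := andP uv.
  have [q [q0 qr qr2 _]] := exists_below3 r0 r20 r20.
  have [||r3 r30 meet_r] := @meet_near R (tangent e 1).1 (tangent e 1).2 _ _ He Hf _ _ q q0.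
  - by rewrite ef.
  - rewrite -!dot_functionalr pmulr_rlt0 // /dot -!expr2.
    exact: sum_sqr_gt0 (cross_neq0l ul).
  have [t' [t'0 t'3 t'r t'r2]] := exists_below3 r30 r0 r20.
  have [|s' s'P E'] := meet_r t'; first by rewrite t'0.
  rewrite -!dot_functionalr in E'.
  have [s'q s'1] := andP s'P.
  have s'r : 1 - r < s' < 1 by rewrite s'1 andbT (lt_trans _ s'q) // ltrD2l ltrN2.
  have s'r2 : 1 - r2 < s' < 1 by rewrite s'1 andbT (lt_trans _ s'q) // ltrD2l ltrN2.
  have t'P : 0 < t' < r by rewrite t'0.
  have t'P2 : 0 < t' < r2 by rewrite t'0.
  have := left_r s' t' s'r t'P E'; rewrite nb.
  by rewrite ltNge ltW // left_r2.
by clear; case: b; case: (0 < _).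
Qed.
End GraphWinding.

(** * Winding of a cycle *)

Section CycleWinding.
Variables (R : realType) (n : nat) (G : drawn_digraph R n) (l : R * R).
Local Open Scope classical_set_scope.
Hypotheses (planar : planar_drawing G) (gauge : gauge_direction G l).

Lemma curve_C1 (e : edge G) : C1_arc (curve e).
Proof. by have [_ _ C1 _ _] := planar; apply: C1. Qed.

Lemma gauge_neq0 : l <> (0, 0).
Proof. by have [] := gauge. Qed.

Lemma internal_transversal (e : edge G) t : internal_edge e -> 0 <= t <= 1 ->
  cross (tangent e t) l != 0.
Proof. by move=> ie t01; have [_ _ tr _] := gauge; rewrite crossC oppr_eq0 tr. Qed.

(** The type [R *l R] carries the lexicographic order used in [turning_parity]. *)
Definition lex_pos (x : 'I_n + ivertex G) : R *l R := (cross (pos x) l, dot (pos x) l).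

Lemma lex_pos_inj : injective lex_pos.
Proof.
move=> x y [E1 E2]; have [pos_inj _ _ _ _] := planar; apply: pos_inj.
by apply: (cross_dot_inj gauge_neq0).
Qed.

Definition abscissa (a : R *l R) : R := a.1.

Lemma abscissa_homo : {homo abscissa : a b / (a <= b)%O >-> a <= b}.
Proof. by move=> a b; rewrite leEprodlexi => /andP []. Qed.

Lemma lt_lex_fst (a b : R *l R) : a.1 != b.1 -> (a < b)%O = (a.1 < b.1).
Proof. by rewrite ltEprodlexi; case: (ltgtP a.1 b.1). Qed.

Lemma internal_edge_monotone (e : edge G) : internal_edge e ->
  (lex_pos (src e)).1 != (lex_pos (tgt e)).1 /\
  forall t, 0 <= t <= 1 ->
    ((lex_pos (src e)).1 < (lex_pos (tgt e)).1) = (0 < cross (tangent e t) l).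
Proof.
move=> ie; have [_ ends _ _ _] := planar; have [e0 e1] := ends e.
have ne t : 0 <= t <= 1 -> functional l.2 (- l.1) (velocity (curve e) t) != 0.
  by rewrite -cross_functionall; apply: internal_transversal.
have := functional_mono (s := 0) (t := 1) (curve_C1 e) ne (lexx _) ltr01 (lexx _).
rewrite /lex_pos /= -e0 -e1 ![cross (curve e _) l]cross_functionall.
have z01 : 0 <= (0 : R) <= 1 by rewrite lexx ?ler01.
have [pos0|neg0] := functional_sign (curve_C1 e) ne.
  rewrite pos0 // => lt; split=> [|t t01]; first by rewrite lt_eqF.
  by rewrite lt cross_functionall; apply/esym/pos0.
rewrite lt_gtF ?neg0 // => lt; split=> [|t t01]; first by rewrite gt_eqF.
by rewrite lt_gtF // cross_functionall; apply/esym/lt_gtF/neg0.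
Qed.

Definition is_edge_graph (e : edge G) (g : R -> R) : Prop :=
  [/\ {within [set` xspan abscissa (lex_pos (src e)) (lex_pos (tgt e))], continuous g},
      forall t, 0 <= t <= 1 -> g (cross (curve e t) l) = dot (curve e t) l
    & forall x, x \in xspan abscissa (lex_pos (src e)) (lex_pos (tgt e)) ->
        exists2 t, 0 <= t <= 1 & cross (curve e t) l = x].

Lemma internal_edge_graph (e : edge G) : internal_edge e -> exists g, is_edge_graph e g.
Proof.
move=> ie.
have tr t : 0 <= t <= 1 -> functional l.2 (- l.1) (velocity (curve e) t) != 0.
  by rewrite -cross_functionall; apply: internal_transversal.
have [g [cg gE gS]] := arc_graph l.1 l.2 (curve_C1 e) tr.
have [_ ends _ _ _] := planar; have [e0 e1] := ends e.
exists g; split.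
- by move: cg; rewrite e0 e1 -!cross_functionall.
- by move=> t /gE; rewrite -cross_functionall -dot_functionall.
- move=> x xP; have [|t t01 <-] := gS x; first by rewrite e0 e1 -!cross_functionall.
  by exists t => //; rewrite cross_functionall.
Qed.

Lemma internal_arcs_disjoint (e f : edge G) s t : e != f -> 0 < s < 1 -> 0 < t < 1 ->
  curve e s <> curve f t.
Proof.
move=> ef sP tP E; have [_ _ _ _ cr] := planar.
have [||[/eqP]|[]] := cr e f s t _ _ E; try lra; first by rewrite (negPf ef).
Qed.

(** This is [turning_parity] for the edges seen as graphs over the abscissa. Where the cycle goes
    straight on the winding is 0; at a fold [odd_wind_fold] reads its parity off the heights. *)
Lemma cycle_winding_odd (p : nat) (E : nat -> edge G) :
  (1 < p)%N -> E p = E 0 -> E p.+1 = E 1 -> (forall i, internal_edge (E i)) ->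
  (forall i, tgt (E i) = src (E i.+1)) ->
  {in gtn p &, injective (fun i => src (E i))} ->
  (forall i, (0 < i < p)%N -> (lex_pos (src (E 0)) < lex_pos (src (E i)))%O) ->
  \big[addb/false]_(i < p) odd `|wind l (E i) (E i.+1)|%N = true.
Proof.
move=> p1 Ep Ep1 iE tE inj min0.
have /choice [g gP] : forall e, exists h, internal_edge e -> is_edge_graph e h.
  move=> e; have [/internal_edge_graph [h hP]|ne] := boolP (internal_edge e).
    by exists h.
  by exists (fun=> 0).
have [_ ends _ _ cr] := planar.
pose P i := lex_pos (src (E i)).
have tP i : lex_pos (tgt (E i)) = P i.+1 by rewrite tE.
have mono i := internal_edge_monotone (iE i).
have ne01 i j : (i < j < p)%N -> E i != E j.
  by move=> ijp; apply/eqP => Eij; have := inj i j; rewrite !inE /= Eij => /(_ _ _ erefl); lia.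
have neS i : E i != E i.+1.
  apply/eqP => Ei; have [+ _] := mono i.
  by rewrite tP /P -Ei eqxx.
have z01 : 0 <= (0 : R) <= 1 by rewrite lexx ?ler01.
have o01 : 0 <= (1 : R) <= 1 by rewrite lexx ?ler01.
(* Along an edge the abscissa moves in the direction given by the sign of [cross (tangent _ _) l],
   so turning back is a change of this sign at the vertex. *)
have tb i : turned_back (P i) (P i.+1) (P i.+2) =
    (cross (tangent (E i) 1) l * cross (tangent (E i.+1) 0) l < 0).
  have [ne1 /(_ 1 o01)] := mono i; have [ne2 /(_ 0 z01)] := mono i.+1.
  rewrite !tP -!/(P _) in ne1 ne2 * => lt2 lt1.
  have := internal_transversal (iE i) o01; have := internal_transversal (iE i.+1) z01.
  move=> v0 u0; rewrite /turned_back !lt_lex_fst // 1?eq_sym //.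
  have flip (x y : R) : x != y -> (y < x) = ~~ (x < y).
    by move=> xy; rewrite -leNgt le_eqVlt eq_sym (negPf xy).
  rewrite (flip _ _ ne1) (flip _ _ ne2) lt1 lt2.
  set a := cross _ l in u0 *; set b := cross _ l in v0 *.
  case: (ltgtP 0 a) u0 => // a0 _; case: (ltgtP 0 b) v0 => // b0 _ /=;
    by rewrite ?(pmulr_rlt0 _ a0) ?(nmulr_rlt0 _ a0) ?b0 ?(lt_gtF b0).
have l0 := gauge_neq0.
apply: (@turning_parity _ _ _ abscissa (fun a : R *l R => a.2) abscissa_homo
  p P (fun i => g (E i)) (fun i => odd `|wind l (E i) (E i.+1)|%N)) => //.
- by rewrite /P Ep.
- by rewrite /P Ep1.
- by rewrite Ep.
- by move=> i j ip jp /lex_pos_inj; apply: inj.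
- by move=> i _; have [+ _] := mono i; rewrite tP.
- move=> i _; have [_ gE _] := gP _ (iE i); have [e0 e1] := ends (E i).
  have := gE 0 z01; have := gE 1 o01; rewrite e0 e1 tE => -> ->.
  by [].
- by move=> i _; have [+ _ _] := gP _ (iE i); rewrite tP.
(* Equal abscissa and height mean a common point of two curves, which planarity allows only at their
   ends. *)
- move=> i j x ijp xi xj gij.
  have [_ giE giS] := gP _ (iE i); have [_ gjE gjS] := gP _ (iE j).
  have [s s01 Es] := giS x ltac:(by rewrite tP).
  have [t t01 Et] := gjS x ltac:(by rewrite tP).
  have Est : curve (E i) s = curve (E j) t.
    apply: (cross_dot_inj l0); first by rewrite Es Et.
    by rewrite -giE // -gjE // Es Et.
  have [[/eqP]|[s_end t_end]] := cr _ _ s t s01 t01 Est.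
    by rewrite (negPf (ne01 i j ijp)).
  pose q := curve (E i) s; exists (cross q l, dot q l); split=> //.
    have [e0 e1] := ends (E i).
    by rewrite /q !inE; case: s_end => ->; rewrite ?e0 ?e1 ?tE ?eqxx ?orbT.
  have [e0 e1] := ends (E j).
  by rewrite /q Est !inE; case: t_end => ->; rewrite ?e0 ?e1 ?tE ?eqxx ?orbT.
- move=> i _; rewrite tb -leNgt => st; rewrite /wind.
  have st' : 0 < cross (tangent (E i) 1) l * cross (tangent (E i.+1) 0) l.
    by rewrite lt_neqAle st andbT eq_sym mulf_neq0 ?internal_transversal.
  case: ifPn => [ap|_]; last by rewrite wind_generic_straight.
  by have := antiparallel_fold ap (internal_transversal (iE i) o01); rewrite ltNge st.
- move=> i _; rewrite tb => fold.
  have ends_eq : curve (E i) 1 = curve (E i.+1) 0.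
    by have [_ ->] := ends (E i); have [-> _] := ends (E i.+1); rewrite tE.
  have tr j z : 0 <= z <= 1 -> cross (tangent (E j) z) l != 0.
    exact: internal_transversal.
  have disj s t : 0 < s < 1 -> 0 < t < 1 -> curve (E i) s <> curve (E i.+1) t.
    by apply: internal_arcs_disjoint.
  have [s [t [sP tP' Est ->]]] := odd_wind_fold l0 (curve_C1 (E i)) (curve_C1 (E i.+1))
    ends_eq (tr i) (tr i.+1) disj fold.
  have s01 : 0 <= s <= 1 by move: sP => /andP [/ltW -> /ltW ->].
  have t01 : 0 <= t <= 1 by move: tP' => /andP [/ltW -> /ltW ->].
  have [_ gE _] := gP _ (iE i); have [_ gE' _] := gP _ (iE i.+1).
  have in_span j z : 0 <= z <= 1 ->
      cross (curve (E j) z) l \in xspan abscissa (P j) (P j.+1).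
    move=> z01'; have ne y : 0 <= y <= 1 ->
        functional l.2 (- l.1) (velocity (curve (E j)) y) != 0.
      by rewrite -cross_functionall; apply: tr.
    have := functional_hull (curve_C1 (E j)) ne z01'; have [e0 e1] := ends (E j).
    by rewrite -!cross_functionall e0 e1 tE.
  exists (cross (curve (E i) s) l); rewrite gE // Est gE' //; split=> //.
  + by apply: (not_level l0 disj sP tP' Est).
  + by rewrite -Est; apply: in_span.
  + exact: in_span.
Qed.
End CycleWinding.

(** * Crossings of a gauge ray *)

Section Crossing.
Variable R : realType.
Implicit Types a b c d : R * R.

(** The l^1 distance keeps the estimates linear in absolute values of coordinates. *)
Definition taxi a b : R := `|a.1 - b.1| + `|a.2 - b.2|.

Lemma taxiC a b : taxi a b = taxi b a.
Proof. by rewrite /taxi distrC (distrC a.2). Qed.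

Lemma taxi_triangle b a c : taxi a c <= taxi a b + taxi b c.
Proof.
rewrite /taxi addrACA; apply: lerD.
  by rewrite (_ : a.1 - c.1 = (a.1 - b.1) + (b.1 - c.1)) ?ler_normD //; ring.
by rewrite (_ : a.2 - c.2 = (a.2 - b.2) + (b.2 - c.2)) ?ler_normD //; ring.
Qed.

(* For nearby points away from the origin: does the path from [a] to [b] cross the
   ray from the origin through (0, 1)? *)
Definition upcross a b : bool := ((0 <= a.1) != (0 <= b.1)) && (0 < a.2).

Lemma upcrossxx a : upcross a a = false.
Proof. by rewrite /upcross eqxx. Qed.

(** Straddling the axis forces [|a.1| < eta], hence [|a.2| > eta]. The point [c] is separated by the
    axis from [a] or from [b], so [|c.2| > eta] too, and heights differing by less than [eta] then
    have the same sign. *)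
Lemma same_height (eta : R) a b c :
  2 * eta <= taxi a (0, 0) -> 2 * eta <= taxi b (0, 0) -> 2 * eta <= taxi c (0, 0) ->
  taxi a b < eta -> taxi b c < eta -> taxi a c < eta ->
  (0 <= a.1) != (0 <= b.1) -> (0 < c.2) = (0 < a.2).
Proof.
rewrite /taxi /= !subr0 => fa fb fc ab bc ac side.
have [e0|e0] := ltP 0 eta; last first.
  by have := normr_ge0 (a.1 - b.1); have := normr_ge0 (a.2 - b.2); lra.
have bound (x y : R) : (0 <= x) != (0 <= y) -> `|x| <= `|x - y|.
  case: (leP 0 x) => x0; case: (leP 0 y) => y0 // _.
    by rewrite !ger0_norm //; lra.
  by rewrite !ltr0_norm //; lra.
have a1 := bound _ _ side.
have a2 : eta < `|a.2| by have := normr_ge0 (a.2 - b.2); lra.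
have c1 : `|c.1| < eta.
  have [E|N] := boolP ((0 <= c.1) == (0 <= a.1)).
    have := bound c.1 b.1; rewrite (eqP E) side => /(_ isT).
    by have := normr_ge0 (b.2 - c.2); rewrite (distrC c.1); lra.
  by have := bound _ _ N; have := normr_ge0 (a.2 - c.2); rewrite (distrC c.1); lra.
have c2 : eta < `|c.2| by lra.
have d2 : `|a.2 - c.2| < eta by have := normr_ge0 (a.1 - c.1); lra.
move: d2; rewrite ltr_norml => /andP [d2 d2'].
by apply/idP/idP => h; rewrite ltNge; apply/negP => h';
  move: a2 c2; rewrite ?(gtr0_norm h) ?(ler0_norm h'); lra.
Qed.

Lemma height_near_axis (eta : R) a z : z.1 = 0 -> 2 * eta <= taxi z (0, 0) ->
  taxi a z < eta -> (0 < a.2) = (0 < z.2).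
Proof.
rewrite /taxi /= => ->; rewrite !subr0 normr0 add0r => fz az.
have : `|a.2 - z.2| < eta by have := normr_ge0 a.1; lra.
rewrite ltr_norml => /andP [d1 d2].
by apply/idP/idP => h; rewrite ltNge; apply/negP => h';
  move: fz; rewrite ?(ler0_norm h') ?(gtr0_norm h); lra.
Qed.

(** As soon as one step changes sides, the heights involved have a common sign, and both paths from
    [a] to [d] count the same parity of changes of side. *)
Lemma upcross_quad (eta : R) a b c d :
  2 * eta <= taxi a (0, 0) -> 2 * eta <= taxi b (0, 0) ->
  2 * eta <= taxi c (0, 0) -> 2 * eta <= taxi d (0, 0) ->
  taxi a b < eta -> taxi a c < eta -> taxi a d < eta ->
  taxi b c < eta -> taxi b d < eta -> taxi c d < eta ->
  upcross a b (+) upcross b d = upcross a c (+) upcross c d.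
Proof.
move=> fa fb fc fd ab ac ad bc bd cd.
have eta0 : 0 < eta by apply: le_lt_trans ab; rewrite addr_ge0.
have self x : taxi x x < eta by rewrite /taxi !subrr !normr0 addr0.
have H x y z := @same_height eta x y z.
have [E|N] := boolP ((0 <= a.1) == (0 <= b.1)); last first.
  have E1 := H a b b fa fb fb ab (self b) ab N.
  have E2 := H a b c fa fb fc ab bc ac N.
  rewrite /upcross E1 E2; move: N.
  by case: (0 <= a.1); case: (0 <= b.1); case: (0 <= c.1); case: (0 <= d.1);
    case: (0 < a.2).
have [E'|N] := boolP ((0 <= b.1) == (0 <= d.1)); last first.
  have E2 := H b d c fb fd fc bd (_ : taxi d c < eta) bc N; rewrite taxiC in E2.
  have E1 := H b d a fb fd fa bd (_ : taxi d a < eta) (_ : taxi b a < eta) N.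
  rewrite !(taxiC _ a) in E1; rewrite /upcross (E2 cd) (E1 ad ab); move: N.
  by case: (0 <= a.1); case: (0 <= b.1); case: (0 <= c.1); case: (0 <= d.1);
    case: (0 < b.2).
have [E''|N] := boolP ((0 <= a.1) == (0 <= c.1)); last first.
  have E1 := H a c c fa fc fc ac (self c) ac N.
  rewrite /upcross E1; move: N E E'.
  by case: (0 <= a.1); case: (0 <= b.1); case: (0 <= c.1); case: (0 <= d.1);
    case: (0 < a.2).
rewrite /upcross; move: E E' E''.
by case: (0 <= a.1); case: (0 <= b.1); case: (0 <= c.1); case: (0 <= d.1).
Qed.

(** [upcross_quad] on each cell of the ladder; the inner rungs cancel. *)
Lemma upcross_ladder (eta : R) (M : nat) (A B : nat -> R * R) :
  (forall k, (k <= M)%N -> 2 * eta <= taxi (A k) (0, 0)) ->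
  (forall k, (k <= M)%N -> 2 * eta <= taxi (B k) (0, 0)) ->
  (forall k, (k < M)%N -> [/\ taxi (A k) (A k.+1) < eta, taxi (B k) (B k.+1) < eta
    & taxi (A k) (B k.+1) < eta /\ taxi (A k.+1) (B k) < eta]) ->
  (forall k, (k <= M)%N -> taxi (A k) (B k) < eta) ->
  \big[addb/false]_(k < M) upcross (A k) (A k.+1)
  (+) \big[addb/false]_(k < M) upcross (B k) (B k.+1)
  = upcross (A 0) (B 0) (+) upcross (A M) (B M).
Proof.
elim: M => [|M IH] fA fB step rung; first by rewrite !big_ord0 !addbb.
rewrite !big_ord_recr /= addbACA IH; last first.
- by move=> k kM; apply: rung; apply: leqW.
- by move=> k kM; apply: step; apply: leqW.
- by move=> k kM; apply: fB; apply: leqW.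
- by move=> k kM; apply: fA; apply: leqW.
have [AA BB [AB BA]] := step M (leqnn _).
have := @upcross_quad eta (A M) (A M.+1) (B M) (B M.+1) 
  (fA M (leqnSn M)) (fA M.+1 (leqnn _)) (fB M (leqnSn M)) (fB M.+1 (leqnn _))
  AA (rung M (leqnSn _)) AB BA (rung M.+1 (leqnn _)) BB.
by do 6?case: (upcross _ _).
Qed.

(* [theta c] is the parity of the crossings along the straight path from [c] to [o]. *)
Lemma crossing_potential (K : R * R -> Prop) (F : R * R -> R * R) (o : R * R)
    (D eta delta : R) :
  0 < delta ->
  (forall c s, K c -> 0 <= s <= 1 ->
    K (c.1 + s * (o.1 - c.1), c.2 + s * (o.2 - c.2))) ->
  (forall c, K c -> taxi c o <= D) ->
  (forall c, K c -> 2 * eta <= taxi (F c) (0, 0)) ->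
  (forall a b, K a -> K b -> taxi a b < delta -> taxi (F a) (F b) < eta) ->
  exists theta : R * R -> bool, forall a b, K a -> K b -> taxi a b < delta / 2 ->
    theta a (+) theta b = upcross (F a) (F b).
Proof.
move=> d0 star diam far unif.
(* With [M] steps each step towards [o] is at most [D / M < delta / 2]. The rungs are below
   [delta / 2] as well, so the diagonals stay below [delta]. *)
pose M := (Num.truncn (2 * D / delta)).+1.
have M0 : 0 < M%:R :> R by rewrite ltr0n.
have DM : D / M%:R < delta / 2.
  have : 2 * D / delta < M%:R by rewrite truncnS_gt.
  by rewrite !ltr_pdivrMr //; lra.
pose path c k : R * R :=
  (c.1 + (k%:R / M%:R) * (o.1 - c.1), c.2 + (k%:R / M%:R) * (o.2 - c.2)).
exists (fun c => \big[addb/false]_(k < M) upcross (F (path c k)) (F (path c k.+1))).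
move=> a b Ka Kb ab.
have frac k : (k <= M)%N -> 0 <= (k%:R / M%:R : R) <= 1.
  by move=> kM; rewrite divr_ge0 //= ler_pdivrMr // mul1r ler_nat.
have Kpath c k : K c -> (k <= M)%N -> K (path c k) by move=> Kc /frac; apply: star.
have path0 c : path c 0 = c.
  by rewrite /path !mul0r !addr0 -surjective_pairing.
have pathM c : path c M = o.
  rewrite /path divff ?gt_eqF // !mul1r [RHS]surjective_pairing.
  by congr (_, _); ring.
have step c k : K c -> taxi (path c k) (path c k.+1) < delta / 2.
  move=> Kc; apply: le_lt_trans DM; rewrite /taxi /path /=.
  have E x y : x + k%:R / M%:R * y - (x + k.+1%:R / M%:R * y) = - (y / M%:R) :> R.
    by rewrite -natr1; ring.
  rewrite !E !normrN !normrM normfV (gtr0_norm M0) -mulrDl ler_wpM2r ?invr_ge0 ?(ltW M0) //.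
  by have := diam c Kc; rewrite /taxi (distrC c.1) (distrC c.2).
have rung k : (k <= M)%N -> taxi (path a k) (path b k) < delta / 2.
  move=> kM; apply: le_lt_trans ab; rewrite /taxi /path /=.
  have E x y z : x + k%:R / M%:R * (z - x) - (y + k%:R / M%:R * (z - y))
      = (1 - k%:R / M%:R) * (x - y) :> R by ring.
  have /andP [s0 s1] := frac k kM.
  by rewrite !E !normrM -mulrDr ger0_norm ?subr_ge0 // ler_piMl ?addr_ge0 //.
have dd : delta / 2 < delta by rewrite ltr_pdivrMr // ltr_pMr // ltr1n.
rewrite (@upcross_ladder eta M (fun k => F (path a k)) (fun k => F (path b k))); last first.
- by move=> k kM; apply: unif; [exact: Kpath|exact: Kpath|apply: lt_trans dd; apply: rung].
- move=> k kM; have kM' := ltnW kM; split; first 2 last.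
  + split; apply: unif; try by apply: Kpath.
      apply: le_lt_trans (taxi_triangle (path b k) _ _) _.
      by rewrite [delta]splitr ltrD ?rung ?step.
    apply: le_lt_trans (taxi_triangle (path a k) _ _) _.
    by rewrite [delta]splitr taxiC ltrD ?rung ?step.
  + by apply: unif; [exact: Kpath|exact: Kpath|apply: lt_trans dd; apply: step].
  + by apply: unif; [exact: Kpath|exact: Kpath|apply: lt_trans dd; apply: step].
- by move=> k kM; apply: far; apply: Kpath.
- by move=> k kM; apply: far; apply: Kpath.
by rewrite !path0 !pathM upcrossxx addbF.
Qed.
End Crossing.

(** * A crossing potential on the disk away from a boundary point *)

Section DiskPotential.
Variable R : realType.
Local Open Scope classical_set_scope.

(* The minimum of [u + 2 max(eps - w, 0)], which is positive on [A]. *)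
Lemma compact_modulus (T : topologicalType) (A : set T) (u w : T -> R) (eps : R) :
  compact A -> {within A, continuous u} -> {within A, continuous w} ->
  (forall x, A x -> 0 <= u x) -> (forall x, A x -> u x = 0 -> w x < eps) ->
  exists2 delta : R, 0 < delta & forall x, A x -> u x < delta -> w x < eps.
Proof.
move=> cA cu cw u0 uw.
have [A0|] := pselect (A !=set0); last first.
  by move=> nA; exists 1 => // x Ax; case: nA; exists x.
pose h x := u x + (`|eps - w x| + (eps - w x)).
have ch : {within A, continuous h}.
  move=> x; apply: cvgD; first exact: cu.
  have ce : (eps - w y) @[y --> (x : subspace A)] --> eps - w x.
    by apply: cvgB; [apply: cvg_cst|apply: cw].
  by apply: cvgD => //; apply: cvg_norm.
have [m mA mP] := compact_EVT_min A0 cA ch.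
have hpos x : A x -> 0 < h x.
  move=> Ax; have ux := u0 x Ax; have [we|ew] := ltP (w x) eps.
    by apply: ltr_wpDl => //; apply: ltr_wpDl => //; rewrite subr_gt0.
  have : u x != 0 by apply/eqP => /(uw x Ax); rewrite ltNge ew.
  rewrite /h ler0_norm ?subr_le0 // addNr addr0 => ne.
  by rewrite lt_neqAle eq_sym ne.
exists (h m) => [|x Ax ux]; first by apply: hpos; move: mA; rewrite inE.
rewrite ltNge; apply/negP => ew.
have := mP x (mem_set Ax).
by rewrite {2}/h ler0_norm ?subr_le0 // addNr addr0 leNgt ux.
Qed.

Lemma within_fst (T U : topologicalType) (A : set T) (B : set U) (f : T -> R) :
  {within A, continuous f} -> {within A `*` B, continuous (fun p => f p.1)}.
Proof.
move=> /subspace_continuousP cf; apply/subspace_continuousP => -[x y] [/= Ax By].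
apply: cvg_trans (cf x Ax) => P.
move=> /= H; have HH : \forall p \near (x, y), A p.1 -> P (f p.1).
  exists ([set z | A z -> P (f z)], setT) => [|p [/= + _] Ap]; last exact.
  by split => //=; exact: filterT.
by apply: (filterS _ HH) => p /= pP [Ap _]; apply: pP.
Qed.

Lemma within_snd (T U : topologicalType) (A : set T) (B : set U) (f : U -> R) :
  {within B, continuous f} -> {within A `*` B, continuous (fun p => f p.2)}.
Proof.
move=> /subspace_continuousP cf; apply/subspace_continuousP => -[x y] [/= Ax By].
apply: cvg_trans (cf y By) => P.
move=> /= H; have HH : \forall p \near (x, y), B p.2 -> P (f p.2).
  exists (setT, [set z | B z -> P (f z)]) => [|p [/= _ +] Bp]; last exact.
  by split => //=; exact: filterT.
by apply: (filterS _ HH) => p /= pP [_ Bp]; apply: pP.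
Qed.

Lemma within_taxi (T : topologicalType) (A : set T) (f g : T -> R) :
  {within A, continuous f} -> {within A, continuous g} ->
  {within A `*` A, continuous (fun p => taxi (f p.1, g p.1) (f p.2, g p.2))}.
Proof.
move=> cf cg x; rewrite /taxi /=.
by apply: cvgD; apply: cvg_norm; apply: cvgB;
  [apply: within_fst cf x|apply: within_snd cf x|apply: within_fst cg x|apply: within_snd cg x].
Qed.

Lemma continuous_functional (a b : R) : continuous (functional a b).
Proof.
move=> x; apply: cvgD; apply: cvgM; by [exact: cvg_cst|exact: cvg_fst|exact: cvg_snd].
Qed.

Lemma closed_disk_closed : closed (@closed_disk R).
Proof.
apply: (@preimage_closed _ _ (fun p : R * R => p.1 ^+ 2 + p.2 ^+ 2) [set y | y <= 1]).
  move=> x _; rewrite /continuous_at; under eq_fun do rewrite !expr2.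
  by apply: cvgD; apply: cvgM; by [exact: cvg_fst|exact: cvg_snd].
exact: closed_le.
Qed.

Lemma closed_disk_compact : compact (@closed_disk R).
Proof.
have csq : compact ([set` `[-1, 1]%R] `*` [set` `[-1, 1]%R] : set (R * R)).
  by apply: compact_setX; apply: segment_compact.
apply: (subclosed_compact closed_disk_closed csq).
move=> [x y] /=; rewrite /closed_disk /= !in_itv /= => xy.
have abs1 z : z ^+ 2 <= 1 -> -1 <= (z : R) <= 1.
  by move=> z1; rewrite -ler_norml -(@expr_le1 _ 2) // -normrX ger0_norm ?sqr_ge0.
by split; apply: abs1; [have := sqr_ge0 y|have := sqr_ge0 x]; lra.
Qed.

(** The disk without a cap around [x0]; it is compact and, for [0 <= rho <= 2], star-shaped about
    the antipode of [x0]. *)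
Definition disk_segment (x0 : R * R) (rho : R) : set (R * R) :=
  @closed_disk R `&` [set c | dot x0 c <= 1 - rho].

Lemma disk_segment_compact x0 rho : compact (disk_segment x0 rho).
Proof.
apply: subclosed_compact closed_disk_compact _; last by move=> ? [].
apply: closedI; first exact: closed_disk_closed.
apply: (@preimage_closed _ _ (dot x0) [set y | y <= 1 - rho]); last exact: closed_le.
by move=> x _; apply: continuous_functional.
Qed.

Lemma taxi_eq0 (a b : R * R) : taxi a b = 0 -> a = b.
Proof.
rewrite /taxi => /eqP; rewrite paddr_eq0 ?normr_ge0 // !normr_eq0 !subr_eq0.
by move=> /andP [/eqP E1 /eqP E2]; rewrite [a]surjective_pairing [b]surjective_pairing E1 E2.
Qed.

Variables (l x0 : R * R) (phi : R * R -> R * R).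
Hypotheses (l0 : l <> (0, 0)) (x0P : unit_circle x0).
Hypotheses (cphi : {within @closed_disk R, continuous phi}).
Hypotheses (iphi : {in @closed_disk R &, injective phi}).

Definition rel_pos c : R * R :=
  (cross (phi c) l - cross (phi x0) l, dot (phi c) l - dot (phi x0) l).

Lemma within_functional (a b : R) :
  {within @closed_disk R, continuous (fun c => functional a b (phi c))}.
Proof.
move=> x; apply: (@cvg_comp _ _ _ phi (functional a b)); first exact: cphi.
exact: continuous_functional.
Qed.

Lemma within_rel_pos1 : {within @closed_disk R, continuous (fun c => (rel_pos c).1)}.
Proof.
move=> x; apply: cvgB; last exact: cvg_cst.
under eq_fun do rewrite cross_functionall; rewrite cross_functionall.
exact: within_functional.
Qed.

Lemma within_rel_pos2 : {within @closed_disk R, continuous (fun c => (rel_pos c).2)}.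
Proof.
move=> x; apply: cvgB; last exact: cvg_cst.
under eq_fun do rewrite dot_functionall; rewrite dot_functionall.
exact: within_functional.
Qed.

Lemma rel_pos_inj : {in @closed_disk R &, injective rel_pos}.
Proof.
move=> a b aD bD [/addIr E1 /addIr E2]; apply: iphi => //.
exact: cross_dot_inj l0 E1 E2.
Qed.

Lemma rel_pos0 : rel_pos x0 = (0, 0).
Proof. by rewrite /rel_pos !subrr. Qed.

Lemma x0_disk : @closed_disk R x0.
Proof. by move: x0P; rewrite /unit_circle /closed_disk /= => ->. Qed.

Lemma dot_disk_le1 c : closed_disk c -> dot x0 c <= 1.
Proof.
move: x0P; rewrite /unit_circle /closed_disk /dot /= => x01 c1.
have := sqr_ge0 (x0.1 - c.1); have := sqr_ge0 (x0.2 - c.2); nra.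
Qed.

Lemma dot_disk_eq1 c : closed_disk c -> dot x0 c = 1 -> c = x0.
Proof.
move: x0P; rewrite /unit_circle /closed_disk /dot /= => x01 c1 d1.
have s : (c.1 - x0.1) ^+ 2 + (c.2 - x0.2) ^+ 2 == 0.
  by rewrite eq_le addr_ge0 ?sqr_ge0 // andbT; nra.
move: s; rewrite paddr_eq0 ?sqr_ge0 // !sqrf_eq0 !subr_eq0 => /andP [/eqP E1 /eqP E2].
by rewrite [c]surjective_pairing E1 E2 -surjective_pairing.
Qed.

(** On the disk [1 - dot x0 c] vanishes only at [x0], where [rel_pos] is zero. By compactness a
    small value of the former makes the latter smaller than [m]. *)
Lemma boundary_gap (m : R) : 0 < m -> exists rho, [/\ 0 < rho, rho <= 2
  & forall c, closed_disk c -> m <= taxi (rel_pos c) (0, 0) -> dot x0 c <= 1 - rho].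
Proof.
move=> m0.
have [|||||delta d0 dP] := @compact_modulus _ (@closed_disk R)
  (fun c => 1 - dot x0 c) (fun c => taxi (rel_pos c) (0, 0)) m.
- exact: closed_disk_compact.
- by apply: continuous_subspaceT => x; apply: cvgB; [apply: cvg_cst|apply: continuous_functional].
- move=> x; rewrite /taxi /=; apply: cvgD; apply: cvg_norm; apply: cvgB; try exact: cvg_cst.
    exact: within_rel_pos1.
  exact: within_rel_pos2.
- by move=> c /dot_disk_le1; rewrite subr_ge0.
- move=> c cD /eqP; rewrite subr_eq0 eq_sym => /eqP /(dot_disk_eq1 cD) ->.
  by rewrite rel_pos0 /taxi subrr normr0 addr0.
exists (Num.min delta 2); split; first by rewrite lt_min d0 ltr0n.
  by rewrite ge_min lexx orbT.
move=> c cD mc; rewrite lerBrDr -lerBrDl ge_min; apply/orP; left.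
by rewrite leNgt; apply/negP => /(dP c cD); rewrite ltNge mc.
Qed.

(** On the compact segment [rel_pos] avoids a neighbourhood of the origin, and both it and its
    inverse are uniformly continuous. Points with close images are therefore close in the disk,
    where [crossing_potential] applies. *)
Lemma disk_potential (rho : R) : 0 < rho -> rho <= 2 ->
  exists (theta : R * R -> bool) (eta eps : R), [/\ 0 < eps, eps <= eta,
    forall c, disk_segment x0 rho c -> 2 * eta <= taxi (rel_pos c) (0, 0)
    & forall a b, disk_segment x0 rho a -> disk_segment x0 rho b ->
      taxi (rel_pos a) (rel_pos b) < eps ->
      theta a (+) theta b = upcross (rel_pos a) (rel_pos b)].
Proof.
move=> r0 r2; set K := disk_segment x0 rho.
have KD : K `<=` @closed_disk R by move=> c [].
have c1 := continuous_subspaceW KD within_rel_pos1.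
have c2 := continuous_subspaceW KD within_rel_pos2.
have cK : compact K by exact: disk_segment_compact.
(* The centre of the contraction is the point opposite to [x0]. *)
pose o : R * R := (- x0.1, - x0.2).
have oK : K o.
  move: x0P; rewrite /unit_circle /= => x01; split; first by rewrite /closed_disk /= !sqrrN x01.
  by rewrite /= /dot /= !mulrN -!expr2 -opprD x01; lra.
have [|||m mK mP] := @compact_EVT_min _ R (fun c => taxi (rel_pos c) (0, 0)) K.
- by exists o.
- exact: cK.
- move=> x; rewrite /taxi /=; apply: cvgD; apply: cvg_norm; apply: cvgB; try exact: cvg_cst.
    exact: c1.
  exact: c2.
have {}mK : K m by move: mK; rewrite inE.
pose eta := taxi (rel_pos m) (0, 0) / 2.
have eta0 : 0 < eta.
  rewrite divr_gt0 // lt_neqAle addr_ge0 // andbT eq_sym; apply/negP => /eqP /taxi_eq0.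
  rewrite -rel_pos0 => /rel_pos_inj E; have [mD] := mK.
  rewrite /= E ?inE //; last exact: x0_disk.
  by move: x0P; rewrite /unit_circle /dot /= -!expr2 => ->; lra.
have far c : K c -> 2 * eta <= taxi (rel_pos c) (0, 0).
  by move=> Kc; rewrite mulrC divfK //; apply: mP; rewrite inE.
have KK : compact (K `*` K) by apply: compact_setX.
have crel := within_taxi c1 c2.
have cid : {within K `*` K, continuous (fun p : (R * R) * (R * R) => taxi p.1 p.2)}.
  by apply: (within_taxi (f := fst) (g := snd)); apply: continuous_subspaceT => x;
    [exact: cvg_fst|exact: cvg_snd].
have taxi_ge0 (a b : R * R) : 0 <= taxi a b by rewrite addr_ge0.
have taxixx (a : R * R) : taxi a a = 0 by rewrite /taxi !subrr normr0 addr0.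
have [||delta d0 dP] := @compact_modulus _ _ (fun p => taxi p.1 p.2)
    (fun p => taxi (rel_pos p.1) (rel_pos p.2)) eta KK cid crel.
- by move=> p _; apply: taxi_ge0.
- by move=> p _ /taxi_eq0 ->; rewrite taxixx.
have d20 : 0 < delta / 2 by rewrite divr_gt0.
(* The modulus of continuity of the inverse, obtained from injectivity on a compact set. *)
have [||eps e0 eP] := @compact_modulus _ _ (fun p => taxi (rel_pos p.1) (rel_pos p.2))
    (fun p => taxi p.1 p.2) (delta / 2) KK crel cid.
- by move=> p _; apply: taxi_ge0.
- move=> p [/= [p1 _] [p2 _]] /taxi_eq0 /rel_pos_inj ->; rewrite ?inE ?taxixx //.
(* The constant 4 bounds the [taxi] distances in the unit disk, whose coordinates are at most 1 in
   absolute value. *)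
have [||||theta tP] := @crossing_potential R K rel_pos o 4 eta delta d0.
- move=> c s [cD dc] /andP [s0 s1]; have x01 := x0P.
  rewrite /unit_circle /= in x01; rewrite /closed_disk /= in cD.
  have oc : o.1 * c.1 + o.2 * c.2 <= 1.
    rewrite /o /=; have := sqr_ge0 (x0.1 + c.1); have := sqr_ge0 (x0.2 + c.2).
    by rewrite !sqrrD; lra.
  split.
    rewrite /closed_disk /=.
    have -> : (c.1 + s * (o.1 - c.1)) ^+ 2 + (c.2 + s * (o.2 - c.2)) ^+ 2 =
      (1 - s) ^+ 2 * (c.1 ^+ 2 + c.2 ^+ 2) + 2 * (s * (1 - s)) * (o.1 * c.1 + o.2 * c.2)
      + s ^+ 2 * (x0.1 ^+ 2 + x0.2 ^+ 2) by rewrite /o /=; ring.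
    have t0 : 0 <= 1 - s by rewrite subr_ge0.
    have h1 : (1 - s) ^+ 2 * (c.1 ^+ 2 + c.2 ^+ 2) <= (1 - s) ^+ 2.
      by rewrite ler_piMr ?sqr_ge0.
    have h2 : 2 * (s * (1 - s)) * (o.1 * c.1 + o.2 * c.2) <= 2 * (s * (1 - s)).
      by rewrite ler_piMr ?mulr_ge0.
    by rewrite x01; lra.
  rewrite /mkset.
  have -> : dot x0 (c.1 + s * (o.1 - c.1), c.2 + s * (o.2 - c.2)) =
    (1 - s) * dot x0 c - s * (x0.1 ^+ 2 + x0.2 ^+ 2) by rewrite /dot /o /=; ring.
  rewrite x01; rewrite /= in dc.
  have : (1 - s) * dot x0 c <= (1 - s) * (1 - rho) by rewrite ler_wpM2l ?subr_ge0.
  have : 0 <= s * (2 - rho) by rewrite mulr_ge0 ?subr_ge0.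
  by lra.
- have unit_coord (q : R * R) : closed_disk q -> `|q.1| <= 1 /\ `|q.2| <= 1.
    have abs1 (z : R) : z ^+ 2 <= 1 -> `|z| <= 1.
      by move=> z1; rewrite -(@expr_le1 _ 2) // -normrX ger0_norm ?sqr_ge0.
    rewrite /closed_disk /= => qD.
    by split; apply: abs1; [have := sqr_ge0 q.2|have := sqr_ge0 q.1]; lra.
  move=> c [/unit_coord [a1 a2] _]; have [/unit_coord [b1 b2] _] := oK.
  by rewrite /taxi; have := ler_normB c.1 o.1; have := ler_normB c.2 o.2; lra.
- exact: far.
- by move=> a b Ka Kb; apply: (dP (a, b)).
exists theta, eta, (Num.min eps eta); split=> //.
- by rewrite lt_min e0.
- by rewrite ge_min lexx orbT.
by move=> a b Ka Kb; rewrite lt_min => /andP [ab _]; apply: tP => //; apply: (eP (a, b)).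
Qed.
End DiskPotential.

(** * Intersections of internal edges with a gauge ray *)

Section Rays.
Variables (R : realType) (n : nat) (G : drawn_digraph R n) (l : R * R).
Local Open Scope classical_set_scope.

Lemma constant_of_locally_constant (f : R -> bool) (delta : R) : 0 < delta ->
  (forall s t, 0 <= s <= 1 -> 0 <= t <= 1 -> s <= t -> t - s < delta -> f s = f t) ->
  f 0 = f 1.
Proof.
move=> d0 loc; pose M := (Num.truncn (1 / delta)).+1.
have M0 : 0 < M%:R :> R by rewrite ltr0n.
have dM : 1 / delta < M%:R by rewrite truncnS_gt.
have frac k : (k <= M)%N -> 0 <= (k%:R / M%:R : R) <= 1.
  by move=> kM; rewrite divr_ge0 //= ler_pdivrMr // mul1r ler_nat.
have E k : (k <= M)%N -> f 0 = f (k%:R / M%:R).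
  elim: k => [|k IH] kM; first by rewrite mul0r.
  rewrite IH 1?ltnW //; apply: loc; rewrite ?frac // 1?ltnW //.
    by rewrite ler_wpM2r ?invr_ge0 ?(ltW M0) // ler_nat.
  rewrite -mulrBl -natrB // subSnn ltr_pdivrMr // mulrC -ltr_pdivrMr //.
by rewrite (E M (leqnn _)) divff // gt_eqF.
Qed.

Hypotheses (dG : is_disk G) (planar : planar_drawing G) (gauge : gauge_direction G l).
Hypothesis (interval : boundary_vertices_on_interval G).
Variable i : 'I_n.
Hypothesis deg_i : degree (inl i : 'I_n + ivertex G) = 1%N.

Let p0 := pos (inl i : 'I_n + ivertex G).

Definition rel_point (q : R * R) : R * R :=
  (cross q l - cross p0 l, dot q l - dot p0 l).

Lemma boundary_preimage : exists2 x0, unit_circle x0 & disk_map G x0 = p0.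
Proof.
have [p [d [t [bd tP _ _]]]] := interval.
have [/andP [t0 t1] E] := tP i.
have [|x0 x0P Ex] := bd (t i); first by rewrite !ltW.
by exists x0; rewrite // Ex.
Qed.

(** Having degree one, the boundary vertex is an end of some edge, and planarity lets another edge
    pass through it only by an end. The ends of an internal edge are internal vertices, at other
    positions. *)
Lemma edge_avoids_boundary (e : edge G) t : internal_edge e -> 0 <= t <= 1 ->
  curve e t <> p0.
Proof.
move=> ie t01; have [pos_inj ends _ _ cr] := planar.
have z01 : 0 <= (0 : R) <= 1 by rewrite lexx ler01.
have o01 : 0 <= (1 : R) <= 1 by rewrite lexx ler01.
have [g [s [s01 send gs]]] : exists (g : edge G) (s : R),
    [/\ 0 <= s <= 1, s = 0 \/ s = 1 & curve g s = p0].
  have : (0 < indeg (inl i : 'I_n + ivertex G))%N \/ (0 < outdeg (inl i : 'I_n + ivertex G))%N.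
    by move: deg_i; rewrite /degree; case: indeg => [|k] /=; [rewrite add0n => ->; right|left].
  case=> /card_gt0P [g]; rewrite inE => /eqP gi; have [g0 g1] := ends g.
    by exists g, 1; split=> //; [right|rewrite g1 gi].
  by exists g, 0; split=> //; [left|rewrite g0 gi].
move=> E; have tend : t = 0 \/ t = 1.
  by have [[_ ->]|[]] := cr e g t s t01 s01 (etrans E (esym gs)).
have [e0 e1] := ends e; move: ie; rewrite /internal_edge.
by case: tend E => ->; rewrite ?e0 ?e1 => /pos_inj ->; case: (src e).
Qed.

Definition meets_ray (e : edge G) : Prop :=
  exists2 t, 0 <= t <= 1 & cross (curve e t) l = cross p0 l /\ dot p0 l < dot (curve e t) l.

Lemma gauge_rayP q : gauge_ray G l i q <->
  cross q l = cross p0 l /\ dot p0 l < dot q l.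
Proof.
have l0 := gauge_neq0 gauge.
have ll := sum_sqr_gt0 l0.
split=> [[t /= t0 <-]|[E lt]].
  rewrite -/p0 /translate; split; first by rewrite /cross /=; ring.
  have -> : dot (p0.1 + t * l.1, p0.2 + t * l.2) l = dot p0 l + t * (l.1 ^+ 2 + l.2 ^+ 2).
    by rewrite /dot /=; ring.
  by rewrite ltrDl mulr_gt0.
exists ((dot q l - dot p0 l) / (l.1 ^+ 2 + l.2 ^+ 2)) => /=.
  by rewrite divr_gt0 // subr_gt0.
rewrite -/p0 /translate; apply: (cross_dot_inj l0).
  by rewrite E /cross /=; ring.
set c := _ / _; have -> : dot (p0.1 + c * l.1, p0.2 + c * l.2) l =
    dot p0 l + c * (l.1 ^+ 2 + l.2 ^+ 2) by rewrite /dot /=; ring.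
by rewrite divfK ?gt_eqF // addrC subrK.
Qed.

Lemma internal_cross_inj (e : edge G) s t : internal_edge e ->
  0 <= s <= 1 -> 0 <= t <= 1 -> cross (curve e s) l = cross (curve e t) l -> s = t.
Proof.
move=> ie s01 t01; rewrite !cross_functionall.
apply: (functional_inj (curve_C1 planar e)) => // z z01.
by rewrite -cross_functionall; apply: internal_transversal.
Qed.

(** The abscissa is injective along an internal edge, so the ray is met at most once. *)
Lemma odd_card_edge_ray (e : edge G) : internal_edge e ->
  odd #|` fset_set (edge_points e `&` gauge_ray G l i)%classic| = `[< meets_ray e >].
Proof.
move=> ie; case: asboolP => [[t t01 [E lt]]|no].
  rewrite (_ : _ `&` _ = [set curve e t]) ?fset_set1 ?cardfs1 //.
  apply/seteqP; split=> [q [[s s01 <-] /gauge_rayP [Es _]]|_ ->].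
    by rewrite (internal_cross_inj ie s01 t01) // Es.
  by split; [exists t|apply/gauge_rayP].
rewrite (_ : _ `&` _ = set0) ?fset_set0 ?cardfs0 //.
apply/seteqP; split=> // q [[s s01 <-] /gauge_rayP [Es lt]].
by apply: no; exists s.
Qed.

Lemma curve_cross_continuous (e : edge G) : continuous (fun t => (rel_point (curve e t)).1).
Proof.
move=> t; apply: cvgB; last exact: cvg_cst.
under eq_fun do rewrite cross_functionall; rewrite cross_functionall.
exact: (functional_continuous (curve_C1 planar e)).
Qed.

Lemma curve_dot_continuous (e : edge G) : continuous (fun t => (rel_point (curve e t)).2).
Proof.
move=> t; apply: cvgB; last exact: cvg_cst.
under eq_fun do rewrite dot_functionall; rewrite dot_functionall.
exact: (functional_continuous (curve_C1 planar e)).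
Qed.

Lemma rel_point_neq0 q : q <> p0 -> rel_point q <> (0, 0).
Proof.
move=> ne [/eqP E1 /eqP E2]; apply: ne; rewrite !subr_eq0 in E1 E2.
by apply: (cross_dot_inj (gauge_neq0 gauge)); apply/eqP.
Qed.

Lemma edges_gap : exists2 m : R, 0 < m & forall (e : edge G) t, internal_edge e ->
  0 <= t <= 1 -> m <= taxi (rel_point (curve e t)) (0, 0).
Proof.
have /choice [f fP] : forall e : edge G, exists m : R, 0 < m /\ (internal_edge e ->
    forall t, 0 <= t <= 1 -> m <= taxi (rel_point (curve e t)) (0, 0)).
  move=> e; have [ie|_] := boolP (internal_edge e); last by exists 1; split.
  have [|t t01 tP] := @EVT_min R (fun t => taxi (rel_point (curve e t)) (0, 0)) 0 1 ler01.
    apply: continuous_subspaceT => t; rewrite /taxi /=.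
    apply: cvgD; apply: cvg_norm; apply: cvgB; try exact: cvg_cst.
      exact: curve_cross_continuous.
    exact: curve_dot_continuous.
  rewrite in_itv /= in t01.
  exists (taxi (rel_point (curve e t)) (0, 0)); split=> [|_ s s01]; last first.
    by apply: tP; rewrite in_itv.
  rewrite lt_neqAle addr_ge0 // andbT eq_sym; apply/negP => /eqP /taxi_eq0.
  exact: (rel_point_neq0 (edge_avoids_boundary ie t01)).
exists (\big[Num.min/1]_(e : edge G) f e); first by apply: lt_bigmin => // e _; have [] := fP e.
move=> e t ie t01; have [_ /(_ ie t t01)] := fP e; apply: le_trans.
exact: bigmin_le.
Qed.

(* [gauge_direction] keeps internal vertices off the ray, so an internal edge that
   meets it passes from one side of it to the other. *)
Lemma meets_ray_sides (e : edge G) : internal_edge e -> meets_ray e ->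
  (0 <= (rel_point (curve e 0)).1) != (0 <= (rel_point (curve e 1)).1).
Proof.
move=> ie [t /andP [t0 t1] [E lt]].
have [_ _ _ off] := gauge; have [_ ends _ _ _] := planar; have [e0 e1] := ends e.
have t0' : 0 < t.
  rewrite lt_neqAle t0 andbT; apply/eqP => tE; move: ie E lt; rewrite -tE e0 /internal_edge.
  by case: (src e) => // v _ E lt; apply: (off i v); apply/gauge_rayP.
have t1' : t < 1.
  rewrite lt_neqAle t1 andbT; apply/eqP => tE; move: ie E lt; rewrite tE e1 /internal_edge.
  by case: (src e) => // w; case: (tgt e) => // v _ E lt; apply: (off i v); apply/gauge_rayP.
have ne z : 0 <= z <= 1 -> functional l.2 (- l.1) (velocity (curve e) z) != 0.
  by rewrite -cross_functionall; apply: internal_transversal.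
have mono := functional_mono (curve_C1 planar e) ne.
have := mono 0 t (lexx 0) t0' t1; have := mono t 1 t0 t1' (lexx 1).
rewrite -!cross_functionall E /rel_point /= !subr_ge0.
case: ifP => _ lt1 lt2.
  by rewrite (ltW lt1) leNgt lt2.
by rewrite (ltW lt2) leNgt lt1.
Qed.

(** The potential is pulled back from the disk by the inverse of [disk_map]. Along an edge it
    changes only where the ray is crossed, that is, when the side of the vertical line through [p0]
    changes and the edge meets the ray. *)
Lemma ray_parity : exists theta : 'I_n + ivertex G -> bool,
  forall e, internal_edge e -> `[< meets_ray e >] = theta (src e) (+) theta (tgt e).
Proof.
have l0 := gauge_neq0 gauge; have [cphi iphi] := dG.
have [x0 x0P Ex0] := boundary_preimage.
have [m m0 mP] := edges_gap.
have [rho [rho0 rho2 rhoP]] := boundary_gap l x0P cphi m0.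
have [theta [eta [eps [eps0 eps_eta far thetaP]]]] := disk_potential l0 x0P cphi iphi rho0 rho2.
have /choice [inv invP] : forall q, exists c, disk G q -> closed_disk c /\ disk_map G c = q.
  move=> q; have [[c cD Ec]|no] := pselect (disk G q); first by exists c.
  by exists (0, 0) => /no.
have rel_inv q : disk G q -> rel_pos l x0 (disk_map G) (inv q) = rel_point q.
  by move=> /invP [_ E]; rewrite /rel_pos E Ex0.
exists (fun x => theta (inv (pos x))) => e ie.
have [_ ends _ in_disk _] := planar; have [e0 e1] := ends e.
have dE t : 0 <= t <= 1 -> disk G (curve e t) by move=> t01; have [] := in_disk e t t01.
have inK t : 0 <= t <= 1 -> disk_segment x0 rho (inv (curve e t)).
  move=> t01; have [cD _] := invP _ (dE t t01); split=> //=.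
  by apply: rhoP => //; rewrite rel_inv; [exact: mP|exact: dE].
set b := `[< _ >].
have z01 : 0 <= (0 : R) <= 1 by rewrite lexx ler01.
have o01 : 0 <= (1 : R) <= 1 by rewrite lexx ler01.
have far' t : 0 <= t <= 1 -> 2 * eta <= taxi (rel_point (curve e t)) (0, 0).
  by move=> t01; rewrite -rel_inv; [exact/far/inK|exact: dE].
pose U := [set` `[0, 1]%R] : set R.
have cU : compact (U `*` U) by apply: compact_setX; apply: segment_compact.
have [|||||delta d0 dP] := @compact_modulus _ _ (U `*` U) (fun p => `|p.1 - p.2|)
  (fun p => taxi (rel_point (curve e p.1)) (rel_point (curve e p.2))) eps.
- exact: cU.
- apply: continuous_subspaceT => p; apply: cvg_norm.
  by apply: cvgB; [apply: cvg_fst|apply: cvg_snd].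
- apply: (within_taxi (f := fun t => (rel_point (curve e t)).1)
    (g := fun t => (rel_point (curve e t)).2)); apply: continuous_subspaceT.
    exact: curve_cross_continuous.
  exact: curve_dot_continuous.
- by move=> p _.
- by move=> p _ /eqP; rewrite normr_eq0 subr_eq0 => /eqP ->; rewrite /taxi !subrr normr0 addr0.
pose side t := 0 <= (rel_point (curve e t)).1.
have close s t : 0 <= s <= 1 -> 0 <= t <= 1 -> `|s - t| < delta ->
    taxi (rel_point (curve e s)) (rel_point (curve e t)) < eps.
  by move=> s01 t01 st; apply: (dP (s, t)) => //; split; rewrite /= in_itv.
(* If the sides differ, the edge crosses the vertical line at some [r] between [s] and [t]. This is
   its only point there, so it is above [p0] exactly when [b] holds, and [curve e s] is near enough
   to have a relative height of the same sign. *)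
have up s t : 0 <= s <= 1 -> 0 <= t <= 1 -> s <= t -> t - s < delta ->
    upcross (rel_point (curve e s)) (rel_point (curve e t)) = (side s != side t) && b.
  move=> s01 t01 st ts; rewrite /upcross -/(side s) -/(side t).
  have [//|sides] := boolP (side s == side t); rewrite /=.
  have [r [sr rt] r0] : exists2 r, s <= r /\ r <= t & (rel_point (curve e r)).1 = 0.
    have cX : {within `[s, t], continuous (fun r => (rel_point (curve e r)).1)}.
      by apply: continuous_subspaceT; apply: curve_cross_continuous.
    have [|r] := IVT st cX (v := 0); last by rewrite in_itv /= => /andP [sr rt]; exists r.
    rewrite ge_min le_max; move: sides; rewrite /side.
    by case: leP => h1; case: leP => h2 //; rewrite ?(ltW h1) ?(ltW h2) ?orbT.
  have r01 : 0 <= r <= 1.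
    by have [/andP [a _] /andP [_ c]] := (s01, t01); rewrite (le_trans a) ?(le_trans rt).
  have sr_close : taxi (rel_point (curve e s)) (rel_point (curve e r)) < eta.
    apply: lt_le_trans eps_eta; apply: close => //.
    by rewrite distrC ger0_norm ?subr_ge0 // (le_lt_trans _ ts) // lerB.
  have bE : b = (0 < (rel_point (curve e r)).2).
    have Er : cross (curve e r) l = cross p0 l by apply/eqP; rewrite -subr_eq0; apply/eqP.
    rewrite /b /rel_point /= subr_gt0; apply/asboolP/idP => [[t' t'01 [E']]|lt]; last by exists r.
    by rewrite -(internal_cross_inj ie t'01 r01) // E' Er.
  by rewrite bE; apply: (height_near_axis r0 (far' r r01) sr_close).
(* The potential and [side t && b] have equal increments over short intervals, so their sum is
   constant along the edge. *)
have psi : theta (inv (curve e 0)) (+) (side 0 && b) = theta (inv (curve e 1)) (+) (side 1 && b).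
  apply: (constant_of_locally_constant
    (f := fun t => theta (inv (curve e t)) (+) (side t && b)) d0).
  move=> s t s01 t01 st ts; have := thetaP _ _ (inK s s01) (inK t t01).
  rewrite (rel_inv _ (dE s s01)) (rel_inv _ (dE t t01)).
  have st_close : `|s - t| < delta by rewrite distrC ger0_norm ?subr_ge0.
  rewrite up // => /(_ (close s t s01 t01 st_close)).
  by case: (theta _); case: (theta _); case: (side s); case: (side t); case: (b).
have sides : b -> side 0 != side 1 by move=> /asboolP; apply: meets_ray_sides.
move: psi sides; rewrite -e0 -e1.
by case: (theta _); case: (theta _); case: (side 0); case: (side 1); case: (b) => // _ /(_ isT).
Qed.
End Rays.

(** * Conservative flows and the linear system *)

Lemma signz (R : numFieldType) (z : int) : (-1) ^ z = (-1) ^+ odd `|z|%N :> R.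
Proof.
rewrite signr_odd; case: z => k //.
by rewrite NegzE abszN absz_nat -exprnN -exprVn invrN1.
Qed.

Lemma unitmx_solve (R : fieldType) (L : lmodType R) (m : nat) (M : 'M[R]_m)
    (x y : 'I_m -> L) : M \in unitmx ->
  (forall r, \sum_s M r s *: x s = y r) <-> (forall s, x s = \sum_r invmx M s r *: y r).
Proof.
move=> uM.
have act (A B : 'M[R]_m) (z : 'I_m -> L) r :
    \sum_s A r s *: (\sum_t B s t *: z t) = \sum_t (A *m B) r t *: z t.
  under eq_bigr do rewrite scaler_sumr; rewrite exchange_big /=; apply: eq_bigr => t _.
  by rewrite mxE scaler_suml; apply: eq_bigr => s _; rewrite scalerA.
have id (z : 'I_m -> L) r : \sum_t (1%:M : 'M[R]_m) r t *: z t = z r.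
  rewrite (bigD1 r) //= mxE eqxx scale1r big1 ?addr0 // => t /negPf tr.
  by rewrite mxE eq_sym tr scale0r.
split=> H r.
  by under eq_bigr do rewrite -H; rewrite act mulVmx // id.
by under eq_bigr do rewrite H; rewrite act mulmxV // id.
Qed.

Section Flows.
Variables (R : realType) (k n : nat) (G : drawn_digraph R n) (l : R * R).
Hypotheses (hG : plabic G k) (hl : gauge_direction G l).

Let planar : planar_drawing G. Proof. by have [[]] := hG. Qed.

(** The colouring enters the determinant through this fact alone: it forces the cycles of a
    permutation to be simple and pairwise disjoint. *)
Lemma in_or_out_unique (v : ivertex G) :
  (forall e f : edge G, tgt e = inr v -> tgt f = inr v -> e = f) \/
  (forall e f : edge G, src e = inr v -> src f = inr v -> e = f).
Proof.
have [_ _ _ /(_ v) [_ +] _] := hG.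
have only (A : {set edge G}) : #|A| = 1%N -> forall e f, e \in A -> f \in A -> e = f.
  by move=> /eqP/cards1P [g ->] e f /set1P -> /set1P ->.
by case: white => /only H; [left|right] => e f he hf; apply: H; rewrite inE ?he ?hf.
Qed.

(** The two ends of an internal edge have different abscissas. *)
Lemma internal_no_loop (e : edge G) : internal_edge e -> tgt e != src e.
Proof.
move=> ie; have [+ _] := internal_edge_monotone planar hl ie.
by apply: contra_neq => ->.
Qed.

Variables (m : nat) (u : m.-tuple (edge G)) (hu : enumerates_unknowns u).

Lemma unknown_inj : injective (tnth u).
Proof. by have [U _] := hu; apply/tuple_uniqP. Qed.

Lemma unknown_tgt r : exists v, tgt (tnth u r) = inr v.
Proof.
have [_ /(_ (tnth u r))] := hu; rewrite mem_tnth /ends_at_sink.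
by case: (tgt _) => // v _; exists v.
Qed.

Lemma unknownP (e : edge G) v : tgt e = inr v -> exists r, tnth u r = e.
Proof.
move=> te; have [_ /(_ e)] := hu; rewrite /ends_at_sink te => /tnthP [r ->].
by exists r.
Qed.

Definition adj : rel 'I_m := fun r s => tgt (tnth u r) == src (tnth u s).

Lemma adj_irreflexive : irreflexive adj.
Proof.
move=> r; apply/negP => /eqP E; have [v tv] := unknown_tgt r.
have : internal_edge (tnth u r) by rewrite /internal_edge -E tv.
by move=> /internal_no_loop; rewrite E eqxx.
Qed.

(** * The cycles of a permutation that follows the edges *)

Section Admissible.
Variable s : {perm 'I_m}.
Hypothesis adm : forall x, s x != x -> adj x (s x).

Lemma moved_internal x : s x != x -> internal_edge (tnth u x).
Proof.
move=> sx; have [v tv] := unknown_tgt x.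
have : adj ((s^-1)%g x) (s ((s^-1)%g x)).
  by apply: adm; rewrite permKV; apply: contra sx => /eqP E; rewrite {1}E permKV.
rewrite permKV => /eqP E; have [v' tv'] := unknown_tgt ((s^-1)%g x).
by rewrite /internal_edge -E tv' tv.
Qed.

Lemma moved_next x : s x != x -> s (s x) != s x.
Proof. by rewrite (inj_eq perm_inj). Qed.

(** If the common source has one outgoing edge the two edges are equal; if it has one incoming edge,
    their predecessors under [s] are equal. *)
Lemma moved_src_inj x y : s x != x -> s y != y ->
  src (tnth u x) = src (tnth u y) -> x = y.
Proof.
move=> sx sy E.
have prev z : s z != z -> tgt (tnth u ((s^-1)%g z)) = src (tnth u z).
  move=> sz; have : adj ((s^-1)%g z) (s ((s^-1)%g z)).
    by apply: adm; rewrite permKV; apply: contra sz => /eqP E'; rewrite {1}E' permKV.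
  by rewrite permKV => /eqP.
have [v tv] := unknown_tgt ((s^-1)%g x); have sv : src (tnth u x) = inr v by rewrite -prev.
have [i1|o1] := in_or_out_unique v; last by apply: unknown_inj; apply: o1; rewrite -?E.
apply: (@perm_inj _ (s^-1)%g); apply: unknown_inj; apply: i1 => //.
by rewrite prev // -E.
Qed.

(** The orbit is listed from the edge with lexicographically least source, as [cycle_winding_odd]
    requires; its sources are distinct by [moved_src_inj]. *)
Lemma porbit_wind_odd r : s r != r ->
  \big[addb/false]_(x in porbit s r) odd `|wind l (tnth u x) (tnth u (s x))|%N = true.
Proof.
move=> sr.
pose key x := lex_pos l (src (tnth u x)).
have rr : r \in porbit s r := porbit_id s r.
pose r0 := [arg min_(x < r in porbit s r) key x]%O.
have [r0r r0min] : r0 \in porbit s r /\ forall x, x \in porbit s r -> (key r0 <= key x)%O.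
  by rewrite /r0; case: arg_minP.
have Er0 : porbit s r0 = porbit s r by apply/eqP; rewrite eq_porbit_mem.
have mv x : x \in porbit s r -> s x != x by apply: porbit_moved.
set p := #|porbit s r0|.
have sr0 := mv _ r0r.
have itmem i : iter i s r0 \in porbit s r by rewrite -Er0 -permX mem_porbit.
rewrite -Er0.
have -> : \big[addb/false]_(x in porbit s r0) odd `|wind l (tnth u x) (tnth u (s x))|%N =
    \big[addb/false]_(i < p) odd `|wind l (tnth u (iter i s r0)) (tnth u (iter i.+1 s r0))|%N.
  rewrite (eq_bigl _ _ (porbit_traject s r0)) -big_uniq ?uniq_traject_porbit //=.
  rewrite (big_nth r0) big_mkord size_traject; apply: eq_bigr => i _.
  by rewrite nth_traject.
have p1 : (1 < p)%N.
  apply/card_gt1P; exists r0, (s r0); split; first exact: porbit_id.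
    by have := mem_porbit s 1 r0; rewrite expg1.
  by rewrite eq_sym.
have iter_inj i j : (i < p)%N -> (j < p)%N -> iter i s r0 = iter j s r0 -> i = j.
  move=> ip jp E; have := uniq_traject_porbit s r0 => /(nth_uniq r0).
  move=> /(_ i j); rewrite size_traject => /(_ ip jp).
  by rewrite !nth_traject // E eqxx => /esym/eqP.
apply: (cycle_winding_odd planar hl (E := fun i => tnth u (iter i s r0)) p1).
- by rewrite /p iter_porbit.
- by rewrite /= /p iter_porbit.
- by move=> i; apply: moved_internal; apply: mv.
- by move=> i /=; apply/eqP; apply: adm; apply: mv.
- move=> i j ip jp E; apply: iter_inj => //.
  by apply: moved_src_inj E; apply: mv.
- move=> i /andP [i0 ip]; rewrite lt_neqAle r0min // andbT.
  apply/eqP => /(lex_pos_inj planar hl) E.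
  have : 0%N = i by apply: iter_inj => //; [exact: ltn_trans ip|apply: moved_src_inj E; apply: mv].
  by move=> i0'; rewrite -i0' in i0.
Qed.

(** For each ray the parities are the increments of a potential on the vertices, and these cancel
    around a cycle. *)
Lemma porbit_intersections_even r : s r != r ->
  \big[addb/false]_(x in porbit s r) odd (intersections l (tnth u x)) = false.
Proof.
move=> sr.
have mv x : x \in porbit s r -> s x != x by apply: porbit_moved.
have [[dG _] [interval _] [deg_b _] _ _] := hG.
have odd_sum (T : finType) (A : {set T}) (f : T -> nat) :
    odd (\sum_(i in A) f i)%N = \big[addb/false]_(i in A) odd (f i).
  by apply: (big_morph odd) => // a b; rewrite oddD.
under eq_bigr do rewrite /intersections odd_sum.
rewrite exchange_big big1 // => i _ /=.
have [theta thetaP] := ray_parity dG planar hl interval (deg_b i).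
rewrite (eq_bigr (fun x => theta (src (tnth u x)) (+) theta (src (tnth u (s x))))); last first.
  move=> x xr; have ix := moved_internal (mv x xr).
  rewrite (odd_card_edge_ray planar hl) // thetaP //; congr (_ (+) theta _).
  by apply/eqP; apply: adm; apply: mv.
rewrite big_split /= [X in _ (+) X]
  (_ : _ = \big[addb/false]_(x in porbit s r) theta (src (tnth u x))).
  by rewrite addbb.
rewrite [RHS](reindex_inj (@perm_inj _ s)) /=; apply: eq_bigl => x.
by rewrite -!eq_porbit_mem -[s x]/((s ^+ 1)%g x) porbit_perm.
Qed.

Lemma porbit_odd r : s r != r ->
  \big[addb/false]_(x in porbit s r)
    (odd (intersections l (tnth u x)) (+) odd `|wind l (tnth u x) (tnth u (s x))|%N) = true.
Proof.
by move=> sr; rewrite big_split /= porbit_intersections_even // porbit_wind_odd.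
Qed.
End Admissible.

Definition admissible (s : {perm 'I_m}) : bool := [forall x, (s x != x) ==> adj x (s x)].

Lemma admissibleP (s : {perm 'I_m}) : reflect (forall x, s x != x -> adj x (s x)) (admissible s).
Proof. by apply: (iffP forallP) => H x; [apply/implyP|apply/implyP; apply: H]. Qed.

Definition flow_of (s : {perm 'I_m}) : {set edge G} :=
  [set tnth u x | x in [set x | s x != x]]%SET.

Lemma mem_flow_of s x : (tnth u x \in flow_of s) = (s x != x).
Proof. by rewrite mem_imset ?inE //; apply: unknown_inj. Qed.

Lemma flow_of_conservative s : admissible s -> conservative_flow (flow_of s).
Proof.
move=> /admissibleP adm; apply/andP; split; last first.
  by apply/forall_inP => e /imsetP [x]; rewrite inE => sx ->; apply: moved_internal sx.
apply/forallP => v.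
have card_sel (P : pred (edge G)) : #|[set e in flow_of s | P e]%SET| =
    #|[set x | (s x != x) && P (tnth u x)]%SET|.
  rewrite -(card_imset _ unknown_inj); apply: eq_card => e; rewrite inE.
  apply/andP/imsetP => [[/imsetP [x]]|[x]]; rewrite inE.
    by move=> sx -> Px; exists x; rewrite ?inE ?sx.
  by move=> /andP [sx Px] ->; rewrite mem_flow_of.
rewrite !card_sel -(card_imset _ (@perm_inj _ s)); apply/eqP; apply: eq_card => y.
rewrite inE; apply/imsetP/andP => [[x]|[sy /eqP Ey]].
  rewrite inE => /andP [sx /eqP Ex] ->; rewrite moved_next //; split=> //.
  by rewrite -Ex eq_sym; apply: adm.
exists ((s^-1)%g y); last by rewrite permKV.
have sx : s ((s^-1)%g y) != (s^-1)%g y.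
  by rewrite permKV; apply: contra sy => /eqP E; rewrite {1}E permKV.
by rewrite inE sx -Ey; move: (adm _ sx); rewrite permKV.
Qed.

(** The image of a moved edge is the only moved edge starting at its end, so the set of moved edges
    determines the permutation. *)
Lemma flow_of_inj : {in admissible &, injective flow_of}.
Proof.
move=> s t /admissibleP adm_s /admissibleP adm_t E; apply/permP => x.
have mv y : (s y != y) = (t y != y) by rewrite -!mem_flow_of E.
have [sx|sx] := eqVneq (s x) x.
  by rewrite sx; apply/esym/eqP; apply: contraTT (eqxx x) => tx; rewrite -mv sx eqxx in tx.
have tx : t x != x by rewrite -mv.
apply: (moved_src_inj adm_s); [exact: moved_next|by rewrite mv moved_next|].
by rewrite -(eqP (adm_s _ sx)) -(eqP (adm_t _ tx)).
Qed.

(** * The permutation attached to a conservative flow *)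

Section Surjectivity.
Variable C : {set edge G}.
Hypothesis flowC : conservative_flow C.

Lemma flow_internal (e : edge G) : e \in C -> internal_edge e.
Proof. by have /andP [_ /forall_inP] := flowC; apply. Qed.

Lemma flow_tgt (e : edge G) : e \in C -> exists v, tgt e = inr v.
Proof.
move=> /flow_internal; rewrite /internal_edge; case: (src e) => // v'.
by case: (tgt e) => // v _; exists v.
Qed.

Lemma flow_next (e : edge G) : e \in C -> exists2 f, f \in C & src f = tgt e.
Proof.
move=> eC; have [v te] := flow_tgt eC.
have /andP [/forallP /(_ v) /eqP E _] := flowC; rewrite te.
have : (0 < #|[set e in C | tgt e == inr v]%SET|)%N.
  by apply/card_gt0P; exists e; rewrite inE eC te eqxx.
by rewrite E => /card_gt0P [f]; rewrite inE => /andP [fC /eqP sf]; exists f.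
Qed.

(** At a vertex with a single outgoing edge, conservation leaves room for at most one incoming edge
    of the flow. *)
Lemma flow_tgt_inj (e f : edge G) : e \in C -> f \in C -> tgt e = tgt f -> e = f.
Proof.
move=> eC fC E; have [v te] := flow_tgt eC.
have tf : tgt f = inr v by rewrite -E.
have [i1|o1] := in_or_out_unique v; first exact: i1.
have /andP [/forallP /(_ v) /eqP Ec _] := flowC.
have : (#|[set e in C | tgt e == inr v]%SET| <= 1)%N.
  rewrite Ec; apply/card_le1P => a; rewrite inE => /andP [aC /eqP sa] b.
  rewrite !inE; apply/andP/eqP => [[bC /eqP sb]|->]; first exact: o1.
  by rewrite aC sa.
by move/card_le1P => /(_ e); rewrite inE eC te eqxx => /(_ isT f); rewrite !inE fC tf eqxx =>
  /esym/eqP.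
Qed.

(** Edges outside the flow are fixed. Inside it the default of [odflt] never occurs, by
    [flow_succP]. *)
Definition flow_succ (x : 'I_m) : 'I_m :=
  if tnth u x \in C then
    odflt x [pick y | (tnth u y \in C) && (src (tnth u y) == tgt (tnth u x))]
  else x.

Lemma flow_succP x : tnth u x \in C ->
  tnth u (flow_succ x) \in C /\ src (tnth u (flow_succ x)) = tgt (tnth u x).
Proof.
move=> xC; rewrite /flow_succ xC; case: pickP => [y /andP [yC /eqP sy] //|no].
have [f fC sf] := flow_next xC.
have [v tf] := flow_tgt fC; have [y yf] := unknownP tf; have := no y.
by rewrite yf fC sf eqxx.
Qed.

Lemma flow_succ_inj : injective flow_succ.
Proof.
move=> x y E; have [xC|xC] := boolP (tnth u x \in C); have [yC|yC] := boolP (tnth u y \in C).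
- have [_ sx] := flow_succP xC; have [_ sy] := flow_succP yC.
  by apply: unknown_inj; apply: flow_tgt_inj; rewrite // -sx -sy E.
- have [sC _] := flow_succP xC; move: sC; rewrite E /flow_succ (negPf yC).
  by rewrite (negPf yC).
- have [sC _] := flow_succP yC; move: sC; rewrite -E /flow_succ (negPf xC).
  by rewrite (negPf xC).
- by move: E; rewrite /flow_succ (negPf xC) (negPf yC).
Qed.

Lemma flow_succ_moved x : (flow_succ x != x) = (tnth u x \in C).
Proof.
have [xC|xC] := boolP (tnth u x \in C); last by rewrite /flow_succ (negPf xC) eqxx.
have [_ sx] := flow_succP xC; apply/eqP => E; rewrite E in sx.
by have := internal_no_loop (flow_internal xC); rewrite sx eqxx.
Qed.

Lemma flow_of_surj : exists2 s, admissible s & flow_of s = C.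
Proof.
exists (perm flow_succ_inj).
  apply/admissibleP => x; rewrite permE flow_succ_moved => /flow_succP [_ sx].
  by rewrite /adj sx.
apply/setP => e; apply/imsetP/idP => [[x]|eC].
  by rewrite inE permE flow_succ_moved => xC ->.
have [v te] := flow_tgt eC.
by have [x xe] := unknownP te; exists x; rewrite // inE permE flow_succ_moved xe.
Qed.
End Surjectivity.

(** Only the parity of the exponent in [coef] matters, so the matrix has the form treated in
    [det_signed_adjacency]; [flow_of] reindexes the admissible permutations by the conservative
    flows. *)
Lemma det_system_matrix (w : edge G -> R) :
  \det (system_matrix w l u) =
    \sum_(C : {set edge G} | conservative_flow C) \prod_(e in C) w e.
Proof.
pose bit x y := odd (intersections l (tnth u x)) (+) odd `|wind l (tnth u x) (tnth u y)|%N.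
have -> : system_matrix w l u = \matrix_(r, t) ((r == t)%:R -
    (if adj r t then (-1) ^+ bit r t * w (tnth u r) else 0)).
  apply/matrixP => r t; rewrite !mxE /adj; case: ifP => // _; congr (_ - _ * _).
  by rewrite expfzDr ?oppr_eq0 ?oner_eq0 // !signz signr_addb.
rewrite (det_signed_adjacency (fun x => w (tnth u x)) adj_irreflexive); last first.
  by move=> s r adm sr; rewrite porbit_odd.
rewrite (eq_bigl (mem (flow_of @: admissible))) /=; last first.
  move=> C; apply/idP/imsetP => [/flow_of_surj [s adm <-]|[s adm ->]]; first by exists s.
  exact: flow_of_conservative.
rewrite big_imset /=; last by move=> s t; apply: flow_of_inj.
apply: eq_bigr => s _; rewrite big_imset /=; last by move=> x y _ _; apply: unknown_inj.
by apply: eq_bigl => x; rewrite inE.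
Qed.
End Flows.

(** * Unique solvability of the system *)

Section Solution.
Variables (R : realType) (k n : nat) (G : drawn_digraph R n) (l : R * R).
Hypotheses (hG : plabic G k) (hl : gauge_direction G l).
Variables (w : edge G -> R) (hw : forall e, 0 < w e).
Variables (m : nat) (u : m.-tuple (edge G)) (hu : enumerates_unknowns u).

Lemma equations_at_indeg (v : ivertex G) : equations_at v = indeg (inr v : 'I_n + ivertex G).
Proof.
have [_ _ _ /(_ v) [d12 d1] _] := hG; rewrite /equations_at; move: d12 d1; rewrite /degree.
by case: white => -[E|E] d1; rewrite E /=; lia.
Qed.

(** Every vertex has one equation per incoming edge, and the unknowns are the edges entering
    internal vertices; the incidences are counted by edge. *)
Lemma number_of_equations_unknowns : number_of_equations G = m.
Proof.
have [U memu] := hu.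
rewrite -[RHS](size_tuple u) -(card_uniqP U) /number_of_equations.
under eq_bigr do rewrite equations_at_indeg /indeg -sum1_card.
rewrite (exchange_big_dep xpredT) //= -sum1_card [RHS]big_mkcond; apply: eq_bigr => e _.
rewrite memu /ends_at_sink; under eq_bigl do rewrite inE.
case: (tgt e) => [j|v] /=; first by rewrite big_pred0.
by rewrite (big_pred1 v) // => v' /=; rewrite eq_sym.
Qed.

(** The empty flow contributes 1 and the other flows nonnegative products. *)
Lemma det_system_matrix_gt0 : 0 < \det (system_matrix w l u).
Proof.
rewrite (det_system_matrix hG hl hu) (bigD1 finset.set0) /=; last first.
  apply/andP; split; last by apply/forall_inP => e; rewrite inE.
  by apply/forallP => v; apply/eqP; apply: eq_card => e; rewrite !inE.
rewrite big_set0 ltr_pwDl // sumr_ge0 // => C _.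
by apply: prodr_ge0 => e _; apply: ltW.
Qed.

Lemma system_matrix_unit : system_matrix w l u \in unitmx.
Proof. by rewrite unitmxE unitfE gt_eqF // det_system_matrix_gt0. Qed.

(** The values at the sinks are prescribed and form the right-hand side; the inverse of the system
    matrix gives the remaining ones. *)
Lemma unique_edge_vectors (L : vectType R) (B : 'I_n -> L) :
  exists! F : {ffun edge G -> L}, sink_values w l B F /\ vertex_equations w l F.
Proof.
pose K e : L := if tgt e is inl j then ((-1) ^+ intersections l e * w e) *: B j else 0.
pose rhs r := \sum_(f | ends_at_sink f && (src f == tgt (tnth u r))) coef w l (tnth u r) f *: K f.
pose sol s := \sum_r invmx (system_matrix w l u) s r *: rhs r.
pose F := [ffun e => if [pick s | tnth u s == e] is Some s then sol s else K e].
have [U memu] := hu.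
have Fu s : F (tnth u s) = sol s.
  rewrite ffunE; case: pickP => [t /eqP /(unknown_inj hu) ->|/(_ s)] //.
  by rewrite eqxx.
have FK e : ends_at_sink e -> F e = K e.
  move=> es; rewrite ffunE; case: pickP => [t /eqP te|//].
  by have := memu e; rewrite es -te mem_tnth.
have sinkE (F' : {ffun edge G -> L}) :
    sink_values w l B F' <-> forall e, ends_at_sink e -> F' e = K e.
  split=> H e; first by rewrite /ends_at_sink /K; case te : (tgt e) => [j|//] _; apply: H.
  by move=> j te; rewrite H /ends_at_sink /K te.
have solve (F' : {ffun edge G -> L}) : (forall e, ends_at_sink e -> F' e = K e) ->
    vertex_equations w l F' <-> forall s, F' (tnth u s) = sol s.
  move=> HK; have E := vertex_equationsE w l F' hG hu.
  have S := unitmx_solve (fun s => F' (tnth u s)) rhs system_matrix_unit.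
  rewrite -[forall s, F' (tnth u s) = sol s]/(forall s, _ = \sum_r _) -S E.
  have R' r : rhs r = \sum_(f | ends_at_sink f && (src f == tgt (tnth u r)))
      coef w l (tnth u r) f *: F' f.
    by apply: eq_bigr => f /andP [/HK ->].
  by split=> H r; rewrite H R'.
exists F; split.
  by split; [apply/sinkE|apply/(solve _ FK)].
move=> F' [/sinkE HK /(solve _ HK) HF]; apply/ffunP => e.
have [es|ns] := boolP (ends_at_sink e); first by rewrite FK // HK.
have : e \in u by rewrite memu.
by move=> /tnthP [s ->]; rewrite Fu HF.
Qed.
End Solution.

Theorem theorem3p11 (R : realType) (k n : nat) (hkn : (0 < k < n)%N)
    (G : drawn_digraph R n) (hG : plabic G k)
    (w : edge G -> R) (hw : forall e, 0 < w e)
    (l : R * R) (hl : gauge_direction G l)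
    (L : vectType R) (B : 'I_n -> L) (hB : free [seq B j | j in ~: sources G])
    (m : nat) (u : m.-tuple (edge G)) (hu : enumerates_unknowns u) :
  [/\ number_of_equations G = m,
      \rank (system_matrix w l u) = m,
      exists! F : {ffun edge G -> L},
        sink_values w l B F /\ vertex_equations w l F
    & \det (system_matrix w l u) =
        \sum_(C : {set edge G} | conservative_flow C) \prod_(e in C) w e].
Proof.
split.
- exact: (number_of_equations_unknowns hG hu).
- by apply: mxrank_unit; apply: (system_matrix_unit hG hl hw hu).
- exact: (unique_edge_vectors hG hl hw hu).
- exact: (det_system_matrix hG hl hu).
Qed.
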